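(* Let $\mathfrak g$ be $\mathfrak{sl}(2)$ or $\mathfrak{sl}(3)$ over $\mathbb C$, let $\mathfrak n$ be the maximal nilpotent subalgebra of $\mathfrak g$, and let $\mathfrak l_\bullet=\bigoplus_k\mathfrak l_k$, $\mathfrak l_k=\Pi(H^{k+1}(\mathfrak n;\mathfrak n))$, be the associated Lie superalgebra. (1) For $\mathfrak g=\mathfrak{sl}(2)$: $\mathfrak l_\bullet=\mathfrak l_0=\mathrm{Span}(c_1)$ is commutative. (2) For $\mathfrak g=\mathfrak{sl}(3)$: $\mathfrak l_0\simeq\mathfrak{gl}(2)$, with $[b_1,b_2]=c_2-c_1$. Moreover, as $\mathfrak l_0\simeq\mathfrak{gl}(2)$-modules, $$\mathfrak l_{-1}\simeq L^{0;2},\qquad \mathfrak l_1\simeq L^{2;-2}\oplus L^{1;-1},\qquad \mathfrak l_2\simeq L^{1;-3}.$$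
   Context: $L^{m;c}$ denotes the irreducible $\mathfrak{gl}(2)$-module with highest weight $m$ with respect to $\mathfrak{sl}(2)$ and the value $c$ on the center, i.e. on the identity matrix $1_2\in\mathfrak{gl}(2)$. In the identification $\mathfrak l_0\simeq\mathfrak{gl}(2)$ for $\mathfrak{sl}(3)$, $c_i$ corresponds to the matrix unit $E_{ii}$ ($i=1,2$). For $\mathfrak g=\mathfrak{sl}(2)$, $\mathfrak n$ is spanned by the root vector $e_{\alpha_1}$ of the positive root $\alpha_1$, with dual basis $f^{\alpha_1}$, and $c_1=e_{\alpha_1}\otimes f^{\alpha_1}$. For $\mathfrak g=\mathfrak{sl}(3)$, $\mathfrak n$ has basis $e_{\alpha_1},e_{\alpha_2},e_{\alpha_1+\alpha_2}$ (root vectors of a Chevalley basis for the positive roots, $\alpha_1,\alpha_2$ simple), with dual basis $f^{\alpha_1},f^{\alpha_2},f^{\alpha_1+\alpha_2}$; put $c_i=e_{\alpha_i}\otimes f^{\alpha_i}+e_{\alpha_1+\alpha_2}\otimes f^{\alpha_1+\alpha_2}$ for $i=1,2$, $b_1=e_{\alpha_2}\otimes f^{\alpha_1}$, $b_2=e_{\alpha_1}\otimes f^{\alpha_2}$. These are 1-cocycles, identified with their classes in $H^1(\mathfrak n;\mathfrak n)$. $C^k=\mathfrak n\otimes\Lambda^k\mathfrak n^*$ are the cochains of $\mathfrak n$ with adjoint coefficients, with the Chevalley–Eilenberg differential, and $H^k=H^k(\mathfrak n;\mathfrak n)$ is the cohomology. For monomials $a=e_\alpha\otimes f^{\beta_1}\wedge\dots\wedge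 f^{\beta_p}$, $b=e_{\alpha'}\otimes f^{\beta'_1}\wedge\dots\wedge f^{\beta'_q}$ put $$a\cdot b=\sum_{k=1}^{p}(-1)^{p-k}f^{\beta_k}(e_{\alpha'})\,e_\alpha\otimes f^{\beta_1}\wedge\dots\wedge\widehat{f^{\beta_k}}\wedge\dots\wedge f^{\beta_p}\wedge f^{\beta'_1}\wedge\dots\wedge f^{\beta'_q},$$ extended bilinearly, and $[a,b]=a\cdot b-(-1)^{(p-1)(q-1)}b\cdot a$. This makes $\Pi(C^{\bullet+1})$ ($\Pi$ is the change of parity; $C^{k+1}$ sits in degree $k$ with parity $k\bmod 2$) a differential graded Lie superalgebra and induces the Lie superalgebra structure on $\mathfrak l_\bullet$, in which $\mathfrak l_0$ acts on each $\mathfrak l_k$ by the bracket.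
   Formalization: In (1), the sum over k is restricted to k ≥ 0: for sl(2), l_{-1} = H^0(n;n) = n is nonzero and [c_1, e_{α_1}] = e_{α_1}, so l_• = l_0 and commutativity fail if degree -1 is included. *)

(* Defs.v *)
From HB Require Import structures.
From mathcomp Require Import all_boot all_order all_algebra.
From mathcomp Require Import generic_quotient ring_quotient.

Set Implicit Arguments.
Unset Strict Implicit.
Unset Printing Implicit Defensive.

Import GRing.Theory.
Local Open Scope ring_scope.
Local Open Scope quotient_scope.

(* Quotient of a vector space by a subspace: ring_quotient provides the       *)
(* quotient Z-module, to which the scalar multiplication is added.            *)
Section VectorQuotient.
Variables (F : fieldType) (V : vectType F) (W : {vspace V}).

Definition vquot : Type := Quotient.quot (pred_of_vspace W).
HB.instance Definition _ := EqQuotient.on vquot.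
HB.instance Definition _ := GRing.Zmodule.on vquot.

Definition vproj (v : V) : vquot := \pi_vquot v.

Lemma vproj_eq (u v : V) : (vproj u == vproj v) = (u - v \in W).
Proof. by rewrite Quotient.idealrBE. Qed.

Lemma vproj_is_zmod_morphism : zmod_morphism vproj.
Proof.
by move=> u v; apply: (raddfB (\pi_(Quotient.quot (pred_of_vspace W)))).
Qed.
HB.instance Definition _ :=
  GRing.isZmodMorphism.Build V vquot vproj vproj_is_zmod_morphism.

Lemma vprojK (x : vquot) : vproj (repr x) = x.
Proof. exact: reprK. Qed.

Definition vquot_scale (a : F) (x : vquot) : vquot := vproj (a *: repr x).

Lemma vquot_scaleE a v : vquot_scale a (vproj v) = vproj (a *: v).
Proof.
apply/eqP; rewrite vproj_eq -scalerBr memvZ //.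
by rewrite -vproj_eq vprojK.
Qed.

Lemma vquot_scaleA a b x :
  vquot_scale a (vquot_scale b x) = vquot_scale (a * b) x.
Proof. by rewrite -[x]vprojK !vquot_scaleE scalerA. Qed.
Lemma vquot_scale1 : left_id 1 vquot_scale.
Proof. by move=> x; rewrite -[x]vprojK vquot_scaleE scale1r. Qed.
Lemma vquot_scaleDr : right_distributive vquot_scale +%R.
Proof.
move=> a x y; rewrite -[x]vprojK -[y]vprojK -raddfD !vquot_scaleE -raddfD.
by rewrite scalerDr.
Qed.
Lemma vquot_scaleDl x : {morph vquot_scale^~ x : a b / a + b}.
Proof.
by move=> a b /=; rewrite -[x]vprojK !vquot_scaleE -raddfD scalerDl.
Qed.
HB.instance Definition _ := GRing.Zmodule_isLmodule.Build F vquot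
  vquot_scaleA vquot_scale1 vquot_scaleDr vquot_scaleDl.

Lemma vproj_is_scalable : scalable vproj.
Proof. by move=> a v; rewrite -vquot_scaleE. Qed.
HB.instance Definition _ :=
  GRing.isScalable.Build F V vquot *:%R vproj vproj_is_scalable.

End VectorQuotient.

Definition lie (F : fieldType) N (A B : 'M[F]_N) : 'M[F]_N :=
  A *m B - B *m A.

(* A family x i j (i != j) of root vectors, for the roots ε_i - ε_j of        *)
(* sl(N) with respect to the diagonal Cartan subalgebra, belonging to a       *)
(* Chevalley basis: [x_α, x_-α] is the coroot h_α, and the structure          *)
(* constants satisfy c_{α,β} = - c_{-α,-β} (here for α = ε_i - ε_j and        *)
(* β = ε_j - ε_k; the remaining pairs follow by antisymmetry). The positive   *)
(* roots are those with i < j. The values x i i are irrelevant.               *)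
Definition chevalley (F : fieldType) N (x : 'I_N -> 'I_N -> 'M[F]_N) : Prop :=
  [/\ forall i j, i != j -> forall h : 'rV[F]_N,
        lie (diag_mx h) (x i j) = (h 0 i - h 0 j) *: x i j,
      forall i j, i != j -> lie (x i j) (x j i) = delta_mx i i - delta_mx j j
    & forall i j k, i != j -> j != k -> i != k -> forall c c' : F,
        lie (x i j) (x j k) = c *: x i k ->
        lie (x j i) (x k j) = c' *: x k i -> c = - c'].

(* Bases of the maximal nilpotent subalgebra of strictly upper triangular     *)
(* matrices: e_α1, and e_α1, e_α2, e_(α1+α2), in this order.                  *)
Definition nil_sl2 (F : fieldType) (x : 'I_2 -> 'I_2 -> 'M[F]_2) :
  1.-tuple 'M[F]_2 := [tuple x 0 1].
Definition nil_sl3 (F : fieldType) (x : 'I_3 -> 'I_3 -> 'M[F]_3) :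
  3.-tuple 'M[F]_3 := [tuple x 0 1; x 1 2; x 0 2].

(* Below, n is the Lie algebra with basis e_0, ..., e_(d-1), a subalgebra of  *)
(* gl(N), and f^0, ..., f^(d-1) is the dual basis, that is, coord e. An       *)
(* element of n ⊗ Λ n^* is given by its coordinates on the basis              *)
(* e_a ⊗ f^S, where f^S = f^(s_1) ∧ ... ∧ f^(s_k) for s_1 < ... < s_k the     *)
(* elements of S; these are the elements of enum S, in this order.            *)
Section Cochains.
Variables (F : fieldType) (d : nat).

Definition cochain := {ffun 'I_d * {set 'I_d} -> F^o}.
HB.instance Definition _ := Vector.on cochain.

Definition inversions (s : seq 'I_d) : nat :=
  #|[set p : 'I_(size s) * 'I_(size s) |
      (p.1 < p.2)%N && (tnth (in_tuple s) p.2 < tnth (in_tuple s) p.1)%N]|.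

(* e_a ⊗ f^(s_1) ∧ ... ∧ f^(s_k) for an arbitrary list s of indices: zero if  *)
(* an index is repeated, else ± e_a ⊗ f^S with the sign of the sorting        *)
(* permutation.                                                               *)
Definition mono (a : 'I_d) (s : seq 'I_d) : cochain :=
  if uniq s then [ffun p => (-1) ^+ inversions s * (p == (a, [set:: s]))%:R]
  else 0.

(* C^k = n ⊗ Λ^k n^*, with C^k = 0 for k < 0 *)
Definition cochains (k : int) : {vspace cochain} :=
  (\sum_(p : 'I_d * {set 'I_d} | #|p.2|%:Z == k) <[mono p.1 (enum p.2)]>)%VS.

Definition dot_mono (a : 'I_d) (s : seq 'I_d) (a' : 'I_d) (s' : seq 'I_d) :
    cochain :=
  \sum_(k < size s) ((-1) ^+ (size s - k.+1) * (tnth (in_tuple s) k == a')%:R)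
    *: mono a (take k s ++ drop k.+1 s ++ s').

Definition bracket_mono (a : 'I_d) (s : seq 'I_d) (a' : 'I_d) (s' : seq 'I_d) :
    cochain :=
  dot_mono a s a' s' -
  ((-1) ^ (((size s)%:Z - 1) * ((size s')%:Z - 1))) *: dot_mono a' s' a s.

Definition bracket (u v : cochain) : cochain :=
  \sum_p \sum_q (u p * v q)
    *: bracket_mono p.1 (enum p.2) q.1 (enum q.2).

End Cochains.

Section Cohomology.
Variables (F : fieldType) (N d : nat) (e : d.-tuple 'M[F]_N).

(* The Chevalley-Eilenberg differential with adjoint coefficients:            *)
(* d(x ⊗ w) = \sum_i [e_i, x] ⊗ f^i ∧ w + x ⊗ dw, where d is the              *)
(* antiderivation of Λ n^* given by df^b (y, z) = - f^b ([y, z]).             *)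
Definition diff_mono (a : 'I_d) (s : seq 'I_d) : cochain F d :=
  \sum_i \sum_b coord e b (lie (tnth e i) (tnth e a)) *: mono F b (i :: s)
  - \sum_(k < size s) \sum_(i < d) \sum_(j < d | (i < j)%N)
      ((-1) ^+ k * coord e (tnth (in_tuple s) k) (lie (tnth e i) (tnth e j)))
        *: mono F a (take k s ++ [:: i; j] ++ drop k.+1 s).

Definition diff (u : cochain F d) : cochain F d :=
  \sum_p u p *: diff_mono p.1 (enum p.2).

Lemma diff_is_linear : linear diff.
Proof.
move=> a u v; rewrite /diff scaler_sumr -big_split /=.
by apply: eq_bigr => p _; rewrite !ffunE scalerDl scalerA.
Qed.
HB.instance Definition _ :=
  GRing.isLinear.Build F (cochain F d) (cochain F d) *:%R diff diff_is_linear.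

Definition cocycles : {vspace cochain F d} := lker (linfun diff).
Definition coboundaries : {vspace cochain F d} := limg (linfun diff).

(* The total cohomology Z / (B ∩ Z), with B ∩ Z = B since diff squares to     *)
(* zero when <<e>> is a Lie subalgebra. As diff is homogeneous, it is the     *)
(* direct sum of the H^k(n; n); the parity shift enters only through the sign *)
(* in bracket_mono.                                                           *)
Definition lsuper : Type :=
  @vquot F (subvs_of cocycles)
    (linfun (@vsval _ _ cocycles) @^-1: coboundaries)%VS.
HB.instance Definition _ := GRing.Lmodule.on lsuper.

(* The class of c, for c a cocycle. *)
Definition class (c : cochain F d) : lsuper := vproj _ (vsproj cocycles c).

(* The summand l_k, with underlying space H^(k+1)(n; n), for k >= -1; it is   *)
(* zero for k < -1.                                                           *)
Definition lpart (k : int) (x : lsuper) : Prop :=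
  exists2 c, c \in (cocycles :&: cochains F d (k + 1))%VS & x = class c.

(* The bracket induced on cohomology, computed on representatives: cocycles   *)
(* are closed under the bracket of cochains, and the coboundaries form an     *)
(* ideal of them.                                                             *)
Definition lbracket (x y : lsuper) : lsuper :=
  class (bracket (vsval (repr x)) (vsval (repr y))).

End Cohomology.

Section GL2.
Variable F : fieldType.

Definition gl2_module (V : lmodType F) (rho : 'M[F]_2 -> V -> V) : Prop :=
  [/\ forall A, linear (rho A),
      forall v, linear (rho^~ v)
    & forall A B v, rho (lie A B) v = rho A (rho B v) - rho B (rho A v)].

Definition gl2_submodule (V : lmodType F) (rho : 'M[F]_2 -> V -> V)
    (P : V -> Prop) : Prop :=
  [/\ P 0, forall a u v, P u -> P v -> P (a *: u + v)
    & forall A v, P v -> P (rho A v)].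

Definition gl2_irreducible (V : lmodType F) (rho : 'M[F]_2 -> V -> V) : Prop :=
  (exists v : V, v != 0) /\
  forall P, gl2_submodule rho P ->
    (forall v, P v -> v = 0) \/ (forall v, P v).

(* (V, rho) is L^{m;c}. No finiteness is required of V: an irreducible module *)
(* with a highest weight vector of weight m in nat has dimension m + 1.       *)
Definition gl2_L (m : nat) (c : F) (V : lmodType F)
    (rho : 'M[F]_2 -> V -> V) : Prop :=
  [/\ gl2_module rho, gl2_irreducible rho,
      exists v : V, [/\ v != 0, rho (delta_mx 0 1) v = 0
        & rho (delta_mx 0 0 - delta_mx 1 1) v = m%:R *: v]
    & forall v, rho 1%:M v = c *: v].

Definition gl2_sum (V1 V2 : lmodType F) (rho1 : 'M[F]_2 -> V1 -> V1)
    (rho2 : 'M[F]_2 -> V2 -> V2) (A : 'M[F]_2) (v : V1 * V2) : V1 * V2 :=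
  (rho1 A v.1, rho2 A v.2).

(* phi is an isomorphism of Lie algebras from gl(2) onto l_0. *)
Definition gl2_iso_l0 N d (e : d.-tuple 'M[F]_N)
    (phi : {linear 'M[F]_2 -> lsuper e}) : Prop :=
  [/\ injective phi, forall x, lpart 0 x <-> exists A, phi A = x
    & forall A B, phi (lie A B) = lbracket (phi A) (phi B)].

(* l_k, as a gl(2)-module through phi, is isomorphic to (V, rho). *)
Definition lpart_iso N d (e : d.-tuple 'M[F]_N)
    (phi : {linear 'M[F]_2 -> lsuper e}) (k : int)
    (V : lmodType F) (rho : 'M[F]_2 -> V -> V) : Prop :=
  exists psi : {linear V -> lsuper e},
    [/\ injective psi, forall x, lpart k x <-> exists v, psi v = x
      & forall A v, psi (rho A v) = lbracket (phi A) (psi v)].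

End GL2.

(* Main.v *)
From HB Require Import structures.
Require Import Defs.
From mathcomp Require Import all_boot all_order all_algebra.
From mathcomp Require Import boolp reals complex ring.

(** For sl(3), n is the Heisenberg algebra: [e_0, e_1] = t e_2 with t nonzero,
    and the other brackets of basis vectors vanish. Its differential is t times
    an operator D with integer coefficients that does not depend on the root
    vectors ([nil_sl3_heisenberg], [diffE]), so cocycles and coboundaries are
    those of D.

    The cohomology is read off an explicit homotopy h: in each degree there are
    cocycles r_i and linear forms l_i on cochains, vanishing on coboundaries,
    with l_i (r_j) = 2 delta_ij and
    [2 u = \sum_i l_i (u) r_i + 2 (h D u + D h u)].
    Then the classes of the r_i form a basis of the cohomology in that degree
    ([dual_bases_iso]).

    The bracket of cohomology classes is computed on any representatives
    because of the Leibniz rule D [u, v] = [D u, v] - [sigma u, D v], where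
    sigma is the sign of the degree ([leibniz], [lbracket_class]).

    The algebra gl(2) acts on n by derivations: naturally on the span of e_0 and
    e_1, and by the trace on e_2. These derivations, seen as 1-cochains, are the
    r_i in degree 1, and their bracket is that of matrices
    ([bracket_derivation]): this is l_0. In the other degrees the r_i are chosen
    so that these derivations act on them exactly, not only up to coboundaries,
    as gl(2) acts on the monomials X^j of the binary forms of degree m, twisted
    by a power det^s of the determinant ([bracket_expand]). The latter module
    is L^{m; m + 2 s} ([forms_gl2_L]): differentiating a nonzero form enough
    times gives a nonzero constant, and the constant 1 generates all forms.

    All the identities between cochains that are needed are linear or bilinear
    with integer coefficients. They are therefore checked on the 24 monomials
    e_a f^S, by computation in formal sums of monomials with integer
    coefficients ([extend_ev], [bracket_ev], [vanishesP]).

    For sl(2), n is a line: the differential is zero and the computation of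
    l_0 is immediate ([cohomology_line]). *)

Set Implicit Arguments.
Unset Strict Implicit.
Unset Printing Implicit Defensive.

Import Order.TTheory GRing.Theory Num.Theory.
Local Open Scope ring_scope.

(** * Linear maps *)

Lemma linear_comb (F : fieldType) (U V : lmodType F) (f : U -> V) (I : Type)
    (r : seq I) (P : pred I) (a : I -> F) (v : I -> U) : linear f ->
  f (\sum_(i <- r | P i) a i *: v i) = \sum_(i <- r | P i) a i *: f (v i).
Proof.
move=> lf; pose Lf := GRing.isLinear.Build F U V *:%R f lf.
pose f' : {linear U -> V} := HB.pack f Lf.
rewrite -[f]/(f' : _ -> _) linear_sum.
by apply: eq_bigr => i _; rewrite linearZ.
Qed.

Lemma eq_on_delta (F : fieldType) m n (V : lmodType F) (f g : 'M[F]_(m, n) -> V) :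
    linear f -> linear g ->
    (forall i j, f (delta_mx i j) = g (delta_mx i j)) ->
  f =1 g.
Proof.
move=> lf lg fg A; rewrite (matrix_sum_delta A) pair_bigA /=.
by rewrite !linear_comb //; apply: eq_bigr => p _; rewrite fg.
Qed.

Lemma I2P (i : 'I_2) : i = 0 \/ i = 1.
Proof. by case: i => [[|[|//]] ?]; [left | right]; apply: val_inj. Qed.

Lemma big_I2 (V : nmodType) (G : 'I_2 -> V) : \sum_i G i = G 0 + G 1.
Proof.
by rewrite !big_ord_recl big_ord0 addr0; congr (_ + G _); apply: val_inj.
Qed.

(** * Formal sums of monomials *)

Section FormalSums.
Variables (F : numFieldType) (d : nat).

Definition monomial := ('I_d * seq 'I_d)%type.
Definition formal_sum := seq (int * monomial).

(** Recursive count of the inversions, so that signs can be computed. *)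
Fixpoint inv (s : seq 'I_d) : nat :=
  if s is i :: s' then (count (fun j : 'I_d => j < i)%N s' + inv s')%N else 0%N.

Lemma inversionsE (s : seq 'I_d) : inversions s = inv s.
Proof.
have sumE x0 (t : seq 'I_d) : inversions t =
    (\sum_(i < size t) \sum_(j < size t)
       ((i < j) && (nth x0 t j < nth x0 t i)))%N.
  rewrite pair_bigA /= /inversions -sum1_card big_mkcond /=.
  by apply: eq_bigr => p _; rewrite inE !(tnth_nth x0); case: ifP.
elim: s => [|x s IHs]; first by apply: eq_card0 => [[[]]].
rewrite (sumE x) /= big_ord_recl big_ord_recl /= add0n -IHs (sumE x).
congr addn; last by apply: eq_bigr => i _; rewrite big_ord_recl.
rewrite -sum1_count [RHS]big_mkcond (big_nth x) big_mkord.
by apply: eq_bigr => i _; rewrite /= add0n; case: ifP.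
Qed.

(** The coefficient at b, a monomial with increasing exponents, of the possibly
    unsorted monomial t. *)
Definition mono_coef (t b : monomial) : int :=
  if [&& t.1 == b.1, size t.2 == size b.2, uniq t.2 & perm_eq t.2 b.2]
  then (-1) ^+ inv t.2 else 0.

Lemma mono_coord (t : monomial) (p : 'I_d * {set 'I_d}) :
  mono F t.1 t.2 p = (mono_coef t (p.1, enum p.2))%:~R :> F.
Proof.
case: t p => a s [b S]; rewrite /mono /mono_coef /= inversionsE.
have [us|] := boolP (uniq s); last by rewrite !andbF ffunE.
rewrite ffunE xpair_eqE [b == a]eq_sym; case: (a == b) => /=; last first.
  by rewrite mulr0.
have -> : (size s == size (enum S)) && perm_eq s (enum S) = (S == [set:: s]).
  apply/idP/eqP => [/andP[_ /perm_mem sS] | ->].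
    by apply/setP => i; rewrite !inE sS mem_enum.
  have s_enum : perm_eq s (enum [set:: s]).
    by apply: uniq_perm; rewrite ?enum_uniq // => i; rewrite mem_enum inE.
  by rewrite (perm_size s_enum) eqxx.
by case: eqP => _; rewrite ?mulr1 ?mulr0 ?rmorphXn ?rmorphN1.
Qed.

Definition coef (m : formal_sum) (b : monomial) : int :=
  foldr (fun t c => t.1 * mono_coef t.2 b + c) 0 m.

Definition ev (m : formal_sum) : cochain F d :=
  \sum_(t <- m) t.1%:~R *: mono F t.2.1 t.2.2.

Lemma ev_coord m p : ev m p = (coef m (p.1, enum p.2))%:~R :> F.
Proof.
rewrite /ev; elim: m => [|t m IHm]; first by rewrite big_nil ffunE.
by rewrite big_cons /= ffunE IHm intrD intrM -mono_coord ffunE.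
Qed.

Lemma ev_cat m n : ev (m ++ n) = ev m + ev n.
Proof. exact: big_cat. Qed.

Definition fscale (c : int) (m : formal_sum) : formal_sum :=
  [seq (c * t.1, t.2) | t <- m].

Lemma ev_scale c m : ev (fscale c m) = c%:~R *: ev m.
Proof.
rewrite /ev big_map scaler_sumr; apply: eq_bigr => t _.
by rewrite rmorphM scalerA.
Qed.

Definition fsub m n := m ++ fscale (-1) n.

Lemma ev_sub m n : ev (fsub m n) = ev m - ev n.
Proof. by rewrite ev_cat ev_scale rmorphN1 scaleN1r. Qed.

Lemma ev_flatten (T : Type) (f : T -> formal_sum) (s : seq T) :
  ev (flatten [seq f x | x <- s]) = \sum_(x <- s) ev (f x).
Proof.
elim: s => [|x s IHs]; first by rewrite !big_nil /ev big_nil.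
by rewrite /= ev_cat IHs big_cons.
Qed.

(* basis *)
Definition basis_elt (p : 'I_d * {set 'I_d}) : cochain F d :=
  mono F p.1 (enum p.2).

Lemma inv_enum (S : {set 'I_d}) : inv (enum S) = 0%N.
Proof.
have : sorted (fun i j : 'I_d => i < j)%N (enum S).
  rewrite {1}/enum_mem -enumT; apply: sorted_filter.
    by move=> ? ? ?; apply: ltn_trans.
  by have := iota_ltn_sorted 0 d; rewrite -val_enum_ord sorted_map.
elim: (enum S) => //= i s IHs; rewrite path_sortedE; last first.
  by move=> ? ? ?; apply: ltn_trans.
case/andP => /allP lt_i /IHs ->; rewrite addn0; apply/eqP.
rewrite -leqn0 leqNgt -has_count; apply/hasPn => j /lt_i /ltnW.
by rewrite leqNgt.
Qed.

Lemma basis_eltE p q : basis_elt p q = (q == p)%:R.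
Proof.
rewrite /basis_elt (mono_coord (p.1, enum p.2)) /mono_coef /= enum_uniq inv_enum.
have -> : (q == p) = [&& p.1 == q.1, size (enum p.2) == size (enum q.2)
    & perm_eq (enum p.2) (enum q.2)].
  rewrite -pair_eqE /= [q.1 == _]eq_sym; congr (_ && _).
  apply/eqP/andP => [-> // | [_ /perm_mem pq]].
  by apply/setP => i; have := pq i; rewrite !mem_enum.
by case: ifP.
Qed.
Lemma cochain_sum (u : cochain F d) : u = \sum_p u p *: basis_elt p.
Proof.
apply/ffunP => q; rewrite sum_ffunE (bigD1 q) //= !ffunE basis_eltE eqxx.
rewrite [_ *: _]mulr1 big1 ?addr0 // => p /negPf pq.
by rewrite ffunE basis_eltE eq_sym pq [_ *: _]mulr0.
Qed.

End FormalSums.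

Lemma bracket_linearl (F : fieldType) d (v : cochain F d) :
  linear (fun u : cochain F d => bracket u v).
Proof.
move=> a u u' /=; rewrite /bracket scaler_sumr -big_split.
apply: eq_bigr => p _ /=.
rewrite scaler_sumr -big_split; apply: eq_bigr => q _ /=.
by rewrite !ffunE mulrDl scalerDl [in RHS]scalerA mulrA.
Qed.

Lemma bracket_linearr (F : fieldType) d (u : cochain F d) : linear (bracket u).
Proof.
move=> a v v' /=; rewrite /bracket scaler_sumr -big_split.
apply: eq_bigr => p _ /=.
rewrite scaler_sumr -big_split; apply: eq_bigr => q _ /=.
by rewrite !ffunE mulrDr scalerDl [in RHS]scalerA mulrCA.
Qed.

(** * Cochains of a three-dimensional Lie algebra *)

Definition I3 : seq 'I_3 := [:: 0; 1; 2].

Lemma enum_I3 : enum 'I_3 = I3.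
Proof. by apply: (inj_map val_inj); rewrite val_enum_ord. Qed.

Lemma big_I3 (V : nmodType) (G : 'I_3 -> V) : \sum_i G i = \sum_(i <- I3) G i.
Proof. by rewrite -enum_I3 big_enum. Qed.

Definition monomials : seq (monomial 3) :=
  [seq (a, s) | a <- I3,
     s <- [:: [::]; [:: 0]; [:: 1]; [:: 2]; [:: 0; 1]; [:: 0; 2]; [:: 1; 2]; I3]].

(** The left-hand side indexes the coordinates of a cochain. Both lists are
    duplicate-free with 24 elements, so one inclusion is enough. *)
Lemma perm_monomials :
  perm_eq [seq (p.1, enum p.2) | p : 'I_3 * {set 'I_3}] monomials.
Proof.
have enum_inj : injective (fun p : 'I_3 * {set 'I_3} => (p.1, enum p.2)).
  move=> [a S] [b T] [-> ST]; congr pair; apply/setP => i.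
  by rewrite -[in LHS]mem_enum ST mem_enum.
have us : uniq [seq (p.1, enum p.2) | p : 'I_3 * {set 'I_3}].
  by rewrite map_inj_uniq ?enum_uniq.
apply: uniq_perm => //.
have [] // := uniq_min_size us (s2 := monomials).
- move=> t /mapP [[a S] _ ->] /=; apply: allpairs_f.
    by rewrite -enum_I3 mem_enum.
  rewrite {1}/enum_mem -enumT enum_I3 /=.
  by do 3!case: (_ \in S).
by rewrite size_map -cardE card_prod card_ord -cardsT -powersetT card_powerset
  cardsT card_ord.
Qed.

Lemma big_monomials (V : nmodType) (G : monomial 3 -> V) :
  \sum_(p : 'I_3 * {set 'I_3}) G (p.1, enum p.2) = \sum_(t <- monomials) G t.
Proof. by rewrite -(perm_big _ perm_monomials) big_map big_enum. Qed.

Section Reflection.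
Variable F : numFieldType.
Local Notation ev := (@ev F 3).
Local Notation formal_sum := (formal_sum 3).

Definition vanishes (m : formal_sum) : bool :=
  all (fun t => coef m t == 0) monomials.

(** The link between computation and cochains: a formal sum all of whose
    sorted coefficients are the integer 0 evaluates to 0. *)
Lemma vanishesP m : vanishes m -> ev m = 0.
Proof.
move/allP => m0; apply/ffunP => p; rewrite ffunE ev_coord.
have -> : coef m (p.1, enum p.2) = 0; last by [].
by apply/eqP/m0; rewrite -(perm_mem perm_monomials); apply/image_f.
Qed.

(** The sorted form of m: operations on cochains are defined by their values on
    increasing monomials, so their counterparts on formal sums sort first. *)
Definition normal m : formal_sum :=
  [seq c <- [seq (coef m t, t) | t <- monomials] | c.1 != 0].

Definition fextend (g : monomial 3 -> formal_sum) m : formal_sum :=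
  flatten [seq fscale c.1 (g c.2) | c <- normal m].

(** The linear map on cochains whose value on the increasing monomial t is g t,
    and, above, its computable counterpart. *)
Definition extend (g : monomial 3 -> formal_sum) (u : cochain F 3) :
  cochain F 3 := \sum_p u p *: ev (g (p.1, enum p.2)).

Lemma big_normal (V : lmodType F) (G : monomial 3 -> V) m :
  \sum_p ev m p *: G (p.1, enum p.2) = \sum_(c <- normal m) c.1%:~R *: G c.2.
Proof.
rewrite (eq_bigr (fun p : 'I_3 * {set 'I_3} =>
  (coef m (p.1, enum p.2))%:~R *: G (p.1, enum p.2))); last first.
  by move=> p _; rewrite ev_coord.
rewrite (big_monomials (fun t => (coef m t)%:~R *: G t)).
rewrite big_filter [RHS]big_mkcond big_map; apply: eq_bigr => t _ /=.
by case: eqP => [->|] //=; rewrite scale0r.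
Qed.

Lemma extend_is_linear g : linear (extend g).
Proof.
move=> a u v; rewrite /extend scaler_sumr -big_split /=.
by apply: eq_bigr => p _; rewrite !ffunE scalerDl scalerA.
Qed.
HB.instance Definition _ g :=
  GRing.isLinear.Build F (cochain F 3) (cochain F 3) *:%R (extend g)
    (extend_is_linear g).

Lemma extend_ev g m : extend g (ev m) = ev (fextend g m).
Proof.
rewrite /extend (big_normal (fun t => ev (g t))) ev_flatten.
by apply: eq_bigr => c _; rewrite ev_scale.
Qed.

Lemma basis_ev (p : 'I_3 * {set 'I_3}) :
  basis_elt F p = ev [:: (1, (p.1, enum p.2))].
Proof. by rewrite /ev big_seq1 scale1r. Qed.

Lemma eq_on_support (V : lmodType F) (f g : cochain F 3 -> V) (u : cochain F 3) :
    linear f -> linear g ->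
    (forall p : 'I_3 * {set 'I_3}, u p != 0 ->
       f (ev [:: (1, (p.1, enum p.2))]) = g (ev [:: (1, (p.1, enum p.2))])) ->
  f u = g u.
Proof.
move=> lf lg fg; rewrite (cochain_sum u).
rewrite !linear_comb //; apply: eq_bigr => p _.
have [->|up] := eqVneq (u p) 0; first by rewrite !scale0r.
by rewrite basis_ev fg.
Qed.

Lemma eq_on_monomials (V : lmodType F) (f g : cochain F 3 -> V) :
    linear f -> linear g ->
    {in monomials, forall t, f (ev [:: (1, t)]) = g (ev [:: (1, t)])} ->
  f =1 g.
Proof.
move=> lf lg fg u; apply: eq_on_support => // p _; apply: fg.
by rewrite -(perm_mem perm_monomials); apply/image_f.
Qed.

Definition fdot (t t' : monomial 3) : formal_sum :=
  [seq ((-1) ^+ (size t.2 - k.+1), (t.1, take k t.2 ++ drop k.+1 t.2 ++ t'.2))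
     | k <- iota 0 (size t.2) & nth t'.1 t.2 k == t'.1].

Lemma ev_fdot t t' : ev (fdot t t') = dot_mono F t.1 t.2 t'.1 t'.2.
Proof.
rewrite /ev big_map big_filter big_mkcond /dot_mono /=.
rewrite -[X in iota 0 X]subn0 -/(index_iota _ _) big_mkord.
apply: eq_bigr => k _; rewrite (tnth_nth t'.1) /=.
by case: eqP; rewrite ?mulr0 ?scale0r // mulr1 rmorphXn rmorphN1.
Qed.

Definition fbracket_mono (t t' : monomial 3) : formal_sum :=
  fsub (fdot t t')
    (fscale ((-1) ^+ ((size t.2).+1 * (size t'.2).+1)) (fdot t' t)).

(** The sign in the bracket has exponents of the form n - 1, possibly -1; they
    become natural numbers when raised by 2. *)
Lemma expr_pred_invol (x : F) (n : nat) : x * x = 1 -> x ^ (n%:Z - 1) = x ^+ n.+1.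
Proof.
move=> xx; have x0 : x != 0.
  by apply: contraTneq isT => x0; have /esym/eqP := xx; rewrite x0 mul0r oner_eq0.
have xV : x^-1 = x by rewrite -[RHS]mul1r -(mulVf x0) -mulrA xx mulr1.
case: n => [|n]; first by rewrite sub0r exprN1 xV expr1.
by rewrite -addn1 PoszD addrK addn1 !exprS mulrA xx mul1r.
Qed.

Lemma ev_fbracket_mono t t' :
  ev (fbracket_mono t t') = bracket_mono F t.1 t.2 t'.1 t'.2.
Proof.
rewrite ev_sub ev_scale !ev_fdot /bracket_mono; congr (_ - _ *: _).
rewrite -exprz_exp (@expr_pred_invol (-1)) ?mulrNN ?mulr1 // expr_pred_invol; last first.
  by rewrite -expr2 sqrr_sign.
by rewrite -exprM rmorphXn rmorphN1.
Qed.

Definition fbracket m n : formal_sum :=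
  flatten [seq flatten [seq fscale (c.1 * c'.1) (fbracket_mono c.2 c'.2)
    | c' <- normal n] | c <- normal m].

(** Unlike [bracket], the right-hand side computes. *)
Lemma bracket_ev m n : bracket (ev m) (ev n) = ev (fbracket m n).
Proof.
rewrite ev_flatten /bracket.
transitivity (\sum_p ev m p *:
    \sum_q ev n q *: ev (fbracket_mono (p.1, enum p.2) (q.1, enum q.2))).
  apply: eq_bigr => p _; rewrite scaler_sumr; apply: eq_bigr => q _.
  by rewrite scalerA ev_fbracket_mono.
rewrite (big_normal (fun t => \sum_q ev n q *: ev (fbracket_mono t (q.1, enum q.2)))).
apply: eq_bigr => c _.
rewrite (big_normal (fun t => ev (fbracket_mono _ t))) ev_flatten scaler_sumr.
by apply: eq_bigr => c' _; rewrite ev_scale scalerA intrM.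
Qed.

End Reflection.

(** * The differential of the Heisenberg algebra *)

(** Structure constants of the Heisenberg algebra. *)
Definition heis_const (i j b : 'I_3) : int :=
  if [&& i == 0, j == 1 & b == 2] then 1
  else if [&& i == 1, j == 0 & b == 2] then -1 else 0.

(** The first part is [e_1, e_0] f^1 = - e_2 f^1, [e_0, e_1] f^0 = e_2 f^0; the
    second one replaces a factor f^2 by df^2 = - f^0 f^1. *)
Definition heis_diff (t : monomial 3) : formal_sum 3 :=
  (if t.1 == 0 then [:: (-1, (2, 1 :: t.2))]
   else if t.1 == 1 then [:: (1, (2, 0 :: t.2))] else [::]) ++
  [seq (- (-1) ^+ k, (t.1, take k t.2 ++ [:: 0; 1] ++ drop k.+1 t.2))
     | k <- iota 0 (size t.2) & nth t.1 t.2 k == 2].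

Section Differential.
Variables (F : numFieldType) (N : nat) (e : 3.-tuple 'M[F]_N) (t : F).
Hypothesis t_neq0 : t != 0.
Hypothesis coord_lie : forall i j b,
  coord e b (lie (tnth e i) (tnth e j)) = t * (heis_const i j b)%:~R.

Lemma sum_heis_ad (a : 'I_3) (G : 'I_3 -> 'I_3 -> cochain F 3) :
  \sum_i \sum_b (heis_const i a b)%:~R *: G i b =
  if a == 0 then - G 1 2 else if a == 1 then G 0 2 else 0.
Proof.
have scaleE (b : bool) (c c' : int) (v : cochain F 3) :
    (if b then c else c')%:~R *: v = if b then c%:~R *: v else c'%:~R *: v.
  by case: b.
rewrite !big_I3 !big_cons !big_nil !big_I3 !big_cons !big_nil /heis_const /=.
by case: a => [[|[|[|?]]] ?] //=; rewrite !scale0r ?rmorphN1 ?scaleN1r ?scale1r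
  ?add0r ?addr0.
Qed.

Lemma sum_heis_wedge (b : 'I_3) (G : 'I_3 -> 'I_3 -> cochain F 3) :
  \sum_(i < 3) \sum_(j < 3 | (i < j)%N) (heis_const i j b)%:~R *: G i j =
  if b == 2 then G 0 1 else 0.
Proof.
under eq_bigr do rewrite big_mkcond.
rewrite !big_I3 !big_cons !big_nil !big_I3 !big_cons !big_nil /heis_const /=.
by case: eqP => _; rewrite !scale0r ?scale1r ?add0r ?addr0.
Qed.

(** The factor t only rescales the differential, so the cohomology does not
    depend on the root vectors. *)
Lemma diffE u : diff e u = t *: extend heis_diff u.
Proof.
rewrite /diff /extend scaler_sumr; apply: eq_bigr => -[a S] _ /=.
rewrite scalerA [t * _]mulrC -scalerA; congr (_ *: _).
move: (enum S) => s; rewrite ev_cat scalerDr /diff_mono; congr (_ + _).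
  under eq_bigr do under eq_bigr do rewrite coord_lie -scalerA.
  under eq_bigr do rewrite -scaler_sumr.
  rewrite -scaler_sumr sum_heis_ad /=; congr (_ *: _).
  by rewrite !(fun_if (@ev F 3)) /ev !big_seq1 big_nil /= scale1r rmorphN1 scaleN1r.
rewrite /ev big_map big_filter [in RHS]big_mkcond /=.
rewrite -[X in iota 0 X]subn0 -/(index_iota _ _) big_mkord scaler_sumr -sumrN.
apply: eq_bigr => k _.
under eq_bigr do under eq_bigr do rewrite coord_lie mulrCA -!scalerA.
under eq_bigr do rewrite -!scaler_sumr.
rewrite -!scaler_sumr sum_heis_wedge (tnth_nth a) /= -scalerN; congr (_ *: _).
case: eqP => _; last by rewrite scaler0 oppr0.
by rewrite rmorphN rmorphXn rmorphN1 scaleNr.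
Qed.

End Differential.

Definition degree_sign (t : monomial 3) : formal_sum 3 := [:: ((-1) ^+ size t.2, t)].

(** A partial inverse of [heis_diff], zero outside e_2 f^S. The first five
    cases lift e_2 f^0, e_2 f^1, e_2 f^0 f^1 and, modulo e_1 f^0 f^1 and
    e_0 f^0 f^1, also e_2 f^0 f^2 and e_2 f^1 f^2; in the last one
    e_0 f^0 f^2 is one of several lifts of e_2 f^0 f^1 f^2. *)
Definition heis_homotopy (t : monomial 3) : formal_sum 3 :=
  if t.1 != 2 then [::] else
  match map val t.2 with
  | [:: 0%N] => [:: (1, (1, [::]))]
  | [:: 1%N] => [:: (-1, (0, [::]))]
  | [:: 0%N; 1%N] => [:: (-1, (2, [:: 2]))]
  | [:: 0%N; 2%N] => [:: (1, (1, [:: 2]))]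
  | [:: 1%N; 2%N] => [:: (-1, (0, [:: 2]))]
  | [:: 0%N; 1%N; 2%N] => [:: (1, (0, [:: 0; 2]))]
  | _ => [::]
  end.

Definition on_monomials (P : pred (formal_sum 3)) :=
  all (fun t => P [:: (1, t)]) monomials.

Lemma leibniz_check : on_monomials (fun m => on_monomials (fun n =>
  vanishes (fsub (fextend heis_diff (fbracket m n))
   (fsub (fbracket (fextend heis_diff m) n)
     (fbracket (fextend degree_sign m) (fextend heis_diff n)))))).
Proof. by vm_cast_no_check (erefl true). Qed.

Lemma dd_check :
  on_monomials (fun m => vanishes (fextend heis_diff (fextend heis_diff m))).
Proof. by vm_compute. Qed.

Lemma ss_check : on_monomials (fun m =>
  vanishes (fsub (fextend degree_sign (fextend degree_sign m)) m)).
Proof. by vm_compute. Qed.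

Lemma ds_check : on_monomials (fun m =>
  vanishes (fextend heis_diff (fextend degree_sign m) ++
            fextend degree_sign (fextend heis_diff m))).
Proof. by vm_compute. Qed.

(** * Cohomology classes and their bracket *)

Section Classes.
Variables (F : fieldType) (N d : nat) (e : d.-tuple 'M[F]_N).

Lemma class_is_linear : linear (class e).
Proof. by move=> a u v; rewrite /class !linearP. Qed.
HB.instance Definition _ :=
  GRing.isLinear.Build F (cochain F d) (lsuper e) *:%R (class e) class_is_linear.

(** The quotient that defines the cohomology is taken inside the cocycles; this
    brings the vanishing of a class back to cochains. *)
Lemma class_eq0 u : u \in cocycles e -> (class e u == 0) = (u \in coboundaries e).
Proof.
move=> Zu; rewrite /class -[0](raddf0 (@vproj _ _ _)) vproj_eq subr0.
by rewrite -memv_preim lfunE /= vsprojK.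
Qed.

Lemma lsuper_rep (x : lsuper e) :
  vsval (repr x) \in cocycles e /\ class e (vsval (repr x)) = x.
Proof. by split; [apply: subvsP | rewrite /class vsvalK vprojK]. Qed.

(** The bracket of classes is computed on the representatives [repr] chooses;
    they are known only up to coboundaries, in all degrees. *)
Lemma repr_class u : u \in cocycles e ->
  vsval (repr (class e u)) - u \in coboundaries e.
Proof.
move=> Zu; have [Zr clr] := lsuper_rep (class e u).
by rewrite -class_eq0 ?rpredB // linearB /= clr subrr.
Qed.

Lemma mem_cocycles u : (u \in cocycles e) = (diff e u == 0).
Proof. by rewrite memv_ker lfunE. Qed.

Lemma mem_coboundaries u : u \in coboundaries e <-> exists v, u = diff e v.
Proof.
split=> [/memv_imgP[v _ ->] | [v ->]]; first by exists v; rewrite lfunE.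
by rewrite -[diff e v](lfunE (diff e)) memv_img ?memvf.
Qed.

End Classes.

Lemma mem_cochains (F : numFieldType) d k (u : cochain F d) :
  u \in cochains F d k <->
  forall p : 'I_d * {set 'I_d}, #|p.2|%:Z != k -> u p = 0.
Proof.
split=> [/memv_sumP[v v_line ->] p pk | u0].
  rewrite sum_ffunE big1 // => q /eqP qk.
  have /vlineP[c ->] : v q \in <[basis_elt F q]>%VS by apply/v_line/eqP.
  rewrite ffunE basis_eltE; case: eqP => [pq|_]; last by rewrite [_ *: _]mulr0.
  by rewrite pq qk eqxx in pk.
rewrite (cochain_sum u) (bigID (fun p : 'I_d * {set 'I_d} => #|p.2|%:Z == k)) /=.
rewrite [X in _ + X]big1 ?addr0 => [|p /u0 ->]; last by rewrite scale0r.
by apply: memv_sumr => p pk; rewrite memvZ ?memv_line.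
Qed.

Section Bracket.
Variable F : numFieldType.
Implicit Types u v w : cochain F 3.
Local Notation D := (@extend F heis_diff).
Local Notation H := (@extend F heis_homotopy).
Local Notation S := (@extend F degree_sign).

Lemma on_monomialsP P : on_monomials P -> {in monomials, forall t, P [:: (1, t)]}.
Proof. by move/allP. Qed.

Lemma vanishes_sub (m n : formal_sum 3) : vanishes (fsub m n) -> ev F m = ev F n.
Proof. by move/vanishesP => /(_ F)/eqP; rewrite ev_sub subr_eq0 => /eqP. Qed.

Lemma D_D u : D (D u) = 0.
Proof.
move: u; apply: eq_on_monomials => [||t mt] /=; rewrite ?extend_ev.
- by move=> a u v; rewrite !linearP.
- by move=> a u v; rewrite scaler0 addr0.
- exact: vanishesP (on_monomialsP dd_check mt).
Qed.

Lemma S_S u : S (S u) = u.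
Proof.
move: u; apply: eq_on_monomials => [||t mt] /=; rewrite ?extend_ev.
- by move=> a u v; rewrite !linearP.
- by move=> a u v.
- exact: vanishes_sub (on_monomialsP ss_check mt).
Qed.

Lemma D_S u : D (S u) = - S (D u).
Proof.
apply/eqP; rewrite -addr_eq0; apply/eqP.
move: u; apply: eq_on_monomials => [||t mt] /=; rewrite ?extend_ev.
- by move=> a u v; rewrite !linearP scalerDr addrACA.
- by move=> a u v; rewrite scaler0 addr0.
- by rewrite -ev_cat; exact: vanishesP (on_monomialsP ds_check mt).
Qed.

(** S is the sign of the degree, written as an operator so that the rule also
    holds for cochains that are not homogeneous, as the representatives chosen
    by [repr] need not be. *)
Lemma leibniz u v :
  D (bracket u v) = bracket (D u) v - bracket (S u) (D v).
Proof.
have lin_r (w : cochain F 3) := bracket_linearr w.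
have lin_l (w : cochain F 3) := bracket_linearl w.
move: u; apply: eq_on_monomials => [a u w|a u w|t mt].
- by rewrite lin_l linearP.
- by rewrite !linearP !lin_l scalerBr opprD addrACA.
move: v; apply: eq_on_monomials => [a u w|a u w|t' mt'].
- by rewrite lin_r linearP.
- by rewrite !linearP !lin_r scalerBr opprD addrACA.
rewrite !extend_ev !bracket_ev !extend_ev -ev_sub.
exact: vanishes_sub (on_monomialsP (on_monomialsP leibniz_check mt) mt').
Qed.

Variables (N : nat) (e : 3.-tuple 'M[F]_N) (t : F).
Hypothesis t_neq0 : t != 0.
Hypothesis coord_lie : forall i j b,
  coord e b (lie (tnth e i) (tnth e j)) = t * (heis_const i j b)%:~R.

Lemma cocyclesE u : (u \in cocycles e) = (D u == 0).
Proof. by rewrite mem_cocycles (diffE coord_lie) scaler_eq0 (negPf t_neq0). Qed.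

Lemma coboundariesE u : u \in coboundaries e <-> exists v, u = D v.
Proof.
split=> [/mem_coboundaries[v ->] | [v ->]].
  by exists (t *: v); rewrite (diffE coord_lie) linearZ.
apply/mem_coboundaries; exists (t^-1 *: v).
by rewrite (diffE coord_lie) linearZ /= scalerA mulfV ?scale1r.
Qed.

(** By the Leibniz rule the bracket of a coboundary D w with a cocycle v is
    D [w, v], and that of a cocycle u with D w' is - D [S u, w']. *)
Lemma lbracket_class u v : u \in cocycles e -> v \in cocycles e ->
  lbracket (class e u) (class e v) = class e (bracket u v).
Proof.
move=> Zu Zv; rewrite /lbracket.
have [w /eqP] := (coboundariesE _).1 (repr_class Zu).
rewrite subr_eq => /eqP ->.
have [w' /eqP] := (coboundariesE _).1 (repr_class Zv).
rewrite subr_eq => /eqP ->.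
move: Zu Zv; rewrite !cocyclesE => /eqP Du /eqP Dv.
have bl a b (c : cochain F 3) : bracket (a + b) c = bracket a c + bracket b c.
  by rewrite -[a]scale1r bracket_linearl !scale1r.
have br a b (c : cochain F 3) : bracket c (a + b) = bracket c a + bracket c b.
  by rewrite -[a]scale1r bracket_linearr !scale1r.
have br0 (c : cochain F 3) : bracket c 0 = 0.
  by have := bracket_linearr c (-1) 0 0; rewrite scaleN1r addr0 oppr0 scaleN1r addNr.
have bl0 (c : cochain F 3) : bracket 0 c = 0.
  by have := bracket_linearl c (-1) 0 0; rewrite /= scaleN1r addr0 oppr0 scaleN1r addNr.
have -> : bracket (D w + u) (D w' + v) =
    D (bracket w (D w' + v) - bracket (S u) w') + bracket u v.
  rewrite linearB /= !leibniz D_S Du !linearD /= D_D Dv addr0 br0 subr0.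
  by rewrite linear0 oppr0 bl0 oppr0 sub0r opprK S_S bl [bracket u _]br addrA.
rewrite linearD /=; set z := D _.
suff /eqP -> : class e z == 0 by rewrite add0r.
by rewrite class_eq0 ?cocyclesE ?D_D //; apply/coboundariesE; eexists.
Qed.

End Bracket.

(** * Bases of the cohomology *)

Definition formal_pairing (l m : formal_sum 3) : int :=
  foldr (fun c z => c.1 * coef m c.2 + z) 0 (normal l).

(** The r_i are cocycles of degree k, the l_i are linear forms on cochains,
    encoded by their coefficients on monomials, that vanish on coboundaries and
    take the values 2 delta_ij at r_j, and every monomial t of degree k satisfies
    2 t = \sum_i l_i (t) r_i + 2 (h D t + D h t), h being [heis_homotopy]. The
    factor 2 keeps the forms integral for the basis [quadratics]. *)
Definition dual_bases (k : nat) (r l : seq (formal_sum 3)) : bool :=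
  [&& all (fun m => vanishes (fextend heis_diff m)) r,
      all (fun m => all (fun t => (size t.2 != k) ==> (coef m t == 0)) monomials) r,
      on_monomials (fun m => all (fun f => formal_pairing f (fextend heis_diff m) == 0) l),
      all (fun i => all (fun j =>
          formal_pairing (nth [::] l i) (nth [::] r j) == 2 * (i == j)%:Z)
        (iota 0 (size r))) (iota 0 (size r))
    & all (fun t => (size t.2 == k) ==>
        vanishes (fsub (fscale 2 [:: (1, t)])
          (flatten [seq fscale (formal_pairing (nth [::] l i) [:: (1, t)])
                          (nth [::] r i) | i <- iota 0 (size r)] ++
           fscale 2 (fextend heis_homotopy (fextend heis_diff [:: (1, t)]) ++
                     fextend heis_diff (fextend heis_homotopy [:: (1, t)])))))
      monomials].

Definition term (c : int) (a : 'I_3) (s : seq 'I_3) : formal_sum 3 := [:: (c, (a, s))].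

(** The derivation of n given by the matrix unit E_ij: e_j is sent to e_i, and
    e_2 to tr (E_ij) e_2. Thus E_00, E_11, E_10, E_01 are c_1, c_2, b_1, b_2. *)
Definition matrix_unit (i j : 'I_2) : formal_sum 3 :=
  (1, (widen_ord (leqnSn 2) i, [:: widen_ord (leqnSn 2) j])) ::
  (if i == j then term 1 2 [:: 2] else [::]).

Lemma bases0 : dual_bases 0 [:: term 1 2 [::]] [:: term 2 2 [::]].
Proof. by vm_compute. Qed.

Definition matrix_units := [seq matrix_unit i j | i <- [:: 0; 1], j <- [:: 0; 1]].

Lemma bases1 : dual_bases 1 matrix_units
  [:: term 2 0 [:: 0]; term 2 0 [:: 1]; term 2 1 [:: 0]; term 2 1 [:: 1]].
Proof. by vm_compute. Qed.

(** The degree 2 part splits according to the value of the center: the first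
    three cochains correspond to X^0, X^1, X^2 as binary quadratic forms, the
    factors 2 and -2 making the action of E_01 and E_10 the standard one; the
    next two to binary linear forms. *)
Definition quadratics : seq (formal_sum 3) :=
  [:: term 2 0 [:: 1; 2]; term 1 1 [:: 1; 2] ++ term (-1) 0 [:: 0; 2];
      term (-2) 1 [:: 0; 2]].

Definition linears : seq (formal_sum 3) := [:: term 1 0 [:: 0; 1]; term 1 1 [:: 0; 1]].

Definition volumes : seq (formal_sum 3) := [:: term 1 0 I3; term 1 1 I3].

Lemma bases2 : dual_bases 2 (quadratics ++ linears)
  [:: term 1 0 [:: 1; 2]; term 2 1 [:: 1; 2]; term (-1) 1 [:: 0; 2];
      term 2 0 [:: 0; 1] ++ term (-2) 2 [:: 1; 2]; term 2 1 [:: 0; 1] ++ term 2 2 [:: 0; 2]].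
Proof. by vm_compute. Qed.

Lemma bases3 : dual_bases 3 volumes [:: term 2 0 I3; term 2 1 I3].
Proof. by vm_compute. Qed.

(** The derivations E_ij act on r_0, ..., r_m as on the monomials X^j of the
    binary forms of degree m, dehomogenized, twisted by det^s. At the ends j = 0
    and j = m the out-of-range term has coefficient 0. *)
Definition acts_as_forms (m : nat) (s : int) (r : seq (formal_sum 3)) : bool :=
  all (fun j : nat =>
    let act i i' := fbracket (matrix_unit i i') (nth [::] r j) in
    [&& vanishes (fsub (act 0 0) (fscale (m%:Z - j%:Z + s) (nth [::] r j))),
        vanishes (fsub (act 1 1) (fscale (j%:Z + s) (nth [::] r j))),
        vanishes (fsub (act 0 1) (fscale j%:Z (nth [::] r j.-1)))
      & vanishes (fsub (act 1 0) (fscale (m%:Z - j%:Z) (nth [::] r j.+1)))])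
    (iota 0 m.+1).

Lemma forms0 : acts_as_forms 0 1 [:: term 1 2 [::]].
Proof. by vm_compute. Qed.

Lemma forms2 : acts_as_forms 2 (-2) quadratics.
Proof. by vm_compute. Qed.

Lemma forms1 : acts_as_forms 1 (-1) linears.
Proof. by vm_compute. Qed.

Lemma forms3 : acts_as_forms 1 (-2) volumes.
Proof. by vm_compute. Qed.

Lemma matrix_units_check : all (fun i => all (fun j => all (fun k => all (fun l =>
  vanishes (fsub (fbracket (matrix_unit i j) (matrix_unit k l))
    (fsub (fscale (j == k)%:Z (matrix_unit i l)) (fscale (l == i)%:Z (matrix_unit k j)))))
  [:: 0; 1]) [:: 0; 1]) [:: 0; 1]) [:: 0; 1].
Proof. by vm_compute. Qed.

Section Cohomology.
Variable F : numFieldType.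
Implicit Types u v w : cochain F 3.
Local Notation D := (@extend F heis_diff).
Local Notation H := (@extend F heis_homotopy).
Local Notation ev := (@ev F 3).

Definition pairing (l : formal_sum 3) u : F^o := \sum_p ev l p *: u p.

Lemma pairing_is_linear l : linear (pairing l).
Proof.
move=> a u v; rewrite /pairing scaler_sumr -big_split; apply: eq_bigr => p _.
by rewrite !ffunE scalerDr !scalerA mulrC.
Qed.
HB.instance Definition _ l :=
  GRing.isLinear.Build F (cochain F 3) F^o *:%R (pairing l) (pairing_is_linear l).

Lemma pairing_ev l m : pairing l (ev m) = (formal_pairing l m)%:~R :> F.
Proof.
transitivity (\sum_p ev l p *: ((coef m (p.1, enum p.2))%:~R : F^o)).
  by apply: eq_bigr => p _; rewrite (ev_coord _ m).
rewrite (big_normal (fun t => (coef m t)%:~R : F^o)) /formal_pairing.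
elim: (normal l) => [|c n IHn]; first by rewrite big_nil.
by rewrite big_cons /= IHn intrD intrM.
Qed.

Definition comb (r : seq (formal_sum 3)) (x : nat -> F) : cochain F 3 :=
  \sum_(i < size r) x i *: ev (nth [::] r i).

Lemma eq_comb r x y : (forall i, (i < size r)%N -> x i = y i) -> comb r x = comb r y.
Proof. by move=> xy; apply: eq_bigr => i _; rewrite xy. Qed.

Lemma comb_cat r r' x :
  comb (r ++ r') x = comb r x + comb r' (fun i => x (size r + i)%N).
Proof.
rewrite /comb size_cat big_split_ord /=; congr (_ + _); apply: eq_bigr => i _.
  by rewrite nth_cat ltn_ord.
by rewrite nth_cat ltnNge leq_addr /= addKn.
Qed.

Variables (N : nat) (e : 3.-tuple 'M[F]_N) (t : F).
Hypothesis t_neq0 : t != 0.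
Hypothesis coord_lie : forall i j b,
  coord e b (lie (tnth e i) (tnth e j)) = t * (heis_const i j b)%:~R.
Local Notation cocyclesE := (cocyclesE t_neq0 coord_lie).
Local Notation coboundariesE := (coboundariesE t_neq0 coord_lie).

Section DualBases.
Variables (k : nat) (r l : seq (formal_sum 3)).
Hypothesis rl : dual_bases k r l.

Lemma comb_cocycle x : comb r x \in cocycles e.
Proof.
have /and5P[/allP Dr _ _ _ _] := rl.
apply: rpred_sum => i _; apply: rpredZ; rewrite cocyclesE extend_ev.
by apply/eqP/vanishesP/Dr/mem_nth.
Qed.

Lemma comb_cochain x : comb r x \in cochains F 3 k%:Z.
Proof.
have /and5P[_ /allP kr _ _ _] := rl.
apply: rpred_sum => i _; apply: rpredZ; apply/mem_cochains => p pk.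
rewrite ev_coord; have /allP/(_ (p.1, enum p.2)) := kr _ (mem_nth [::] (ltn_ord i)).
rewrite -(perm_mem perm_monomials) image_f // => /(_ isT) /implyP /=.
by rewrite -cardE => /(_ pk)/eqP ->.
Qed.

Lemma comb_pairing x i : (i < size r)%N -> pairing (nth [::] l i) (comb r x) = 2 * x i.
Proof.
move=> ir; have /and5P[_ _ _ /allP dual _] := rl.
rewrite linear_sum (bigD1 (Ordinal ir)) //= linearZ /= pairing_ev.
have lr (j : 'I_(size r)) :
    formal_pairing (nth [::] l i) (nth [::] r j) = 2 * (i == j)%:Z.
  have := dual i; rewrite mem_iota ir => /(_ isT)/allP/(_ (val j)).
  by rewrite mem_iota ltn_ord => /(_ isT)/eqP.
rewrite (lr (Ordinal ir)) /= eqxx big1 => [|j /negPf ij].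
  by rewrite addr0 [_ *: _]mulrC.
rewrite linearZ /= pairing_ev lr eq_sym; move: ij; rewrite -val_eqE /= => ->.
by rewrite scaler0.
Qed.

Lemma pairing_coboundary i w : pairing (nth [::] l i) (D w) = 0.
Proof.
have /and5P[_ _ Dl _ _] := rl.
move: w; apply: eq_on_monomials => [a u v|a u v|m mt].
- by rewrite !linearP.
- by rewrite scaler0 addr0.
rewrite extend_ev pairing_ev; have /allP := on_monomialsP Dl mt.
have [il|li] := ltnP i (size l); last by move=> _; rewrite nth_default.
by move=> /(_ _ (mem_nth [::] il))/eqP ->.
Qed.

(** The linear forms l_i read off the coefficients and do not see coboundaries. *)
Lemma comb_class_inj x : class e (comb r x) = 0 ->
  forall i, (i < size r)%N -> x i = 0.
Proof.
move/eqP; rewrite class_eq0 ?comb_cocycle // => /coboundariesE[w xw] i ir.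
have /eqP := comb_pairing x ir; rewrite xw pairing_coboundary eq_sym mulf_eq0.
by rewrite pnatr_eq0 => /eqP.
Qed.

(** For a cocycle u the homotopy identity leaves the coboundary D h u as the only
    correction to the combination of the r_i. *)
Lemma cocycle_class u : u \in cocycles e -> u \in cochains F 3 k%:Z ->
  class e u = class e (comb r (fun i => 2^-1 * pairing (nth [::] l i) u)).
Proof.
have /and5P[_ _ _ _ /allP split_k] := rl.
rewrite cocyclesE => /eqP Du /mem_cochains uk.
have u2 : 2 *: u = \sum_(i < size r) pairing (nth [::] l i) u *: ev (nth [::] r i)
    + 2 *: (H (D u) + D (H u)).
  have sum_lin a v w :
      \sum_(i < size r) pairing (nth [::] l i) (a *: v + w) *: ev (nth [::] r i)
      = a *: (\sum_(i < size r) pairing (nth [::] l i) v *: ev (nth [::] r i))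
        + \sum_(i < size r) pairing (nth [::] l i) w *: ev (nth [::] r i).
    rewrite scaler_sumr -big_split; apply: eq_bigr => i _ /=.
    by rewrite linearP scalerDl scalerA.
  apply: (@eq_on_support _ _ ( *:%R 2) (fun u => _ + _)) => [a v w|a v w|p up].
  - by rewrite scalerDr !scalerA mulrC.
  - rewrite sum_lin !linearP [a *: (_ + 2 *: _)]scalerDr [RHS]addrACA.
    congr (_ + _); rewrite [in RHS]scalerA mulrC -scalerA -scalerDr.
    by congr (_ *: _); rewrite scalerDr [RHS]addrACA.
  have pk : size (enum p.2) = k.
    by apply/eqP; rewrite -cardE; apply: contraNT up => /uk ->.
  have mp : (p.1, enum p.2) \in monomials.
    by rewrite -(perm_mem perm_monomials); apply/image_f.
  have := split_k _ mp; rewrite pk eqxx => /(@vanishes_sub F).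
  rewrite ev_scale ev_cat ev_flatten ev_scale ev_cat !extend_ev => ->.
  congr (_ + _).
  rewrite -[X in iota 0 X]subn0 -/(index_iota _ _) big_mkord.
  by apply: eq_bigr => i _; rewrite ev_scale pairing_ev.
rewrite Du linear0 add0r in u2.
have uE : u = 2^-1 *: (2 *: u) by rewrite scalerK ?pnatr_eq0.
rewrite [in LHS]uE u2 scalerDr scalerA mulVf ?pnatr_eq0 //.
rewrite scale1r linearD /= [X in _ + X](_ : _ = 0) ?addr0; last first.
  apply/eqP; rewrite class_eq0 ?cocyclesE ?D_D //.
  by apply/coboundariesE; eexists.
congr class; rewrite /comb scaler_sumr; apply: eq_bigr => i _.
by rewrite scalerA.
Qed.

(** The coordinates x may come from any module V, so that V can be chosen with
    its own action of gl(2). *)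
Lemma dual_bases_iso (V : lmodType F) (x : V -> nat -> F) :
    (forall i, linear (fun v : V => x v i : F^o)) ->
    (forall v : V, (forall i, (i < size r)%N -> x v i = 0) -> v = 0) ->
    (forall y, exists v : V, forall i, (i < size r)%N -> x v i = y i) ->
  exists psi : {linear V -> lsuper e},
    [/\ injective psi, forall y, lpart (k%:Z - 1) y <-> exists v : V, psi v = y
      & forall v : V, psi v = class e (comb r (x v))].
Proof.
move=> x_lin x_inj x_surj.
have psi_lin : linear (fun v : V => class e (comb r (x v))).
  move=> a v v'; rewrite -linearP /=; congr class.
  rewrite /comb scaler_sumr -big_split; apply: eq_bigr => i _.
  by rewrite /= x_lin scalerDl scalerA.
pose psi : {linear V -> lsuper e} :=
  HB.pack (fun v : V => class e (comb r (x v)))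
    (GRing.isLinear.Build F V (lsuper e) *:%R _ psi_lin).
exists psi; split=> // [|y].
  by apply: raddf_inj => v /comb_class_inj/x_inj.
rewrite /lpart subrK; split=> [[c] | [v <-]].
  rewrite memv_cap => /andP[Zc kc] ->; rewrite cocycle_class //.
  have [v xv] := x_surj (fun i => 2^-1 * pairing (nth [::] l i) c).
  by exists v; rewrite /psi /= (eq_comb xv).
exists (comb r (x v)) => //.
by rewrite memv_cap comb_cocycle comb_cochain.
Qed.

End DualBases.
End Cohomology.

(** * Binary forms *)

Lemma gl2_mxtrace (F : fieldType) (A : 'M[F]_2) : \tr A = A 0 0 + A 1 1.
Proof.
by rewrite /mxtrace big_I2.
Qed.

Lemma gl2_lieE (F : fieldType) (A B : 'M[F]_2) i j :
  lie A B i j = A i 0 * B 0 j + A i 1 * B 1 j - (B i 0 * A 0 j + B i 1 * A 1 j).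
Proof.
by rewrite /lie !mxE !big_I2.
Qed.

Section BinaryForms.
Variables (F : numFieldType) (m : nat) (s : F).

(** The action of gl(2) on binary forms of degree m in x, y, that is,
    E_00 = x d/dx, E_01 = x d/dy, E_10 = y d/dx, E_11 = y d/dy, plus s times the
    trace, written in the variable X = y / x as a differential operator of order
    1. It makes sense on all polynomials and preserves those of degree at most
    m. *)
Definition form_op (A : 'M[F]_2) (p : {poly F}) : {poly F} :=
  ((m%:R * A 0 0 + s * \tr A)%:P + (m%:R * A 1 0)%:P * 'X) * p +
  ((A 0 1)%:P + (A 1 1 - A 0 0)%:P * 'X - (A 1 0)%:P * 'X^2) * p^`().

Lemma coef_form_op A p i :
  (form_op A p)`_i =
    (m%:R * A 0 0 + s * \tr A + i%:R * (A 1 1 - A 0 0)) * p`_i +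
    A 0 1 * (i.+1%:R * p`_i.+1) +
    (if i is i'.+1 then A 1 0 * ((m%:R - i'%:R) * p`_i') else 0).
Proof.
rewrite /form_op !mulrDl mulNr -!mulrA !coefD coefN !coefCM !coefXM.
have derivE j : p^`()`_j = j.+1%:R * p`_j.+1 by rewrite coef_deriv mulr_natl.
by rewrite !derivE; case: i => [|[|i]] /=; ring.
Qed.

Lemma form_op_linear A : linear (form_op A).
Proof.
move=> a p q; rewrite /form_op derivD derivZ -!mul_polyC; ring.
Qed.

Lemma form_op_linearl p : linear (fun A => form_op A p).
Proof.
move=> a A B; rewrite /form_op !gl2_mxtrace !mxE -!mul_polyC.
rewrite !(rmorphD, rmorphB, rmorphN, rmorphM) /=; ring.
Qed.

Lemma form_op_lie A B p :
  form_op (lie A B) p = form_op A (form_op B p) - form_op B (form_op A p).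
Proof.
rewrite /form_op !gl2_mxtrace !gl2_lieE.
rewrite !(derivD, derivB, derivN, derivM, derivC, derivX, derivXn).
rewrite !(rmorphD, rmorphB, rmorphN, rmorphM) /=; ring.
Qed.

Lemma size_form_op A (p : {poly F}) : (size p <= m.+1)%N -> (size (form_op A p) <= m.+1)%N.
Proof.
move=> /leq_sizeP p0; apply/leq_sizeP => -[|i] // mi.
rewrite coef_form_op p0 // p0 ?(leqW mi) // !mulr0 !add0r.
move: mi; rewrite ltnS leq_eqVlt => /predU1P[->|mi].
  by rewrite subrr mul0r mulr0.
by rewrite p0 ?mulr0.
Qed.

Local Notation forms := {poly_m.+1 F}.

Definition form_act (A : 'M[F]_2) (p : forms) : forms := npolyp m.+1 (form_op A p).

Lemma form_actE A p : val (form_act A p) = form_op A (val p).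
Proof. by rewrite /= npolypK // size_form_op // size_npoly. Qed.

Lemma form_act_module : gl2_module form_act.
Proof.
have valP a (p q : forms) : val (a *: p + q) = a *: val p + val q by [].
split=> [A a p q | p a A B | A B p]; apply: val_inj.
- by rewrite valP !form_actE -form_op_linear.
- by rewrite valP !form_actE -form_op_linearl.
- by rewrite addrC -scaleN1r valP !form_actE scaleN1r addrC form_op_lie.
Qed.

Definition monom (k : nat) : forms := npolyp m.+1 'X^k.

Lemma val_monom k : (k <= m)%N -> val (monom k) = 'X^k.
Proof. by move=> km; rewrite /= npolypK // size_polyXn. Qed.

Lemma forms_sum (p : forms) : p = \sum_(k < m.+1) (val p)`_k *: monom k.
Proof.
apply/npolyP => i; rewrite coefn_sum.
transitivity (\sum_(k < m.+1) (val p)`_k * (i == k)%:R).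
  have [mi|im] := leqP m.+1 i.
    rewrite big_coef_npoly // big1 // => k _.
    by rewrite gtn_eqF ?mulr0 // (leq_trans _ mi).
  rewrite (bigD1 (Ordinal im)) //= eqxx mulr1 big1 ?addr0 // => k.
  by rewrite -val_eqE /= eq_sym => /negPf ->; rewrite mulr0.
apply: eq_bigr => k _.
have -> : polyn ((val p)`_k *: monom k) = (val p)`_k *: val (monom k) by [].
by rewrite coefZ val_monom ?coefXn // -ltnS.
Qed.

Lemma form_op_monom A k :
  form_op A 'X^k =
    (m%:R * A 0 0 + s * \tr A + k%:R * (A 1 1 - A 0 0)) *: 'X^k +
    (A 0 1 * k%:R) *: 'X^(k.-1) + (A 1 0 * (m%:R - k%:R)) *: 'X^(k.+1).
Proof.
rewrite /form_op derivXn -!mul_polyC -mulr_natl.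
rewrite !(rmorphD, rmorphB, rmorphN, rmorphM, rmorph_nat) /=.
by case: k => [|k]; rewrite /= ?expr0 ?exprS; ring.
Qed.

(** The raising operator E_01 = x d/dy becomes d/dX. *)
Lemma form_op_raise p : form_op (delta_mx 0 1) p = p^`().
Proof.
rewrite /form_op gl2_mxtrace !mxE /= !(mulr0, addr0, subr0).
by rewrite polyC0 polyC1; ring.
Qed.

Lemma size_deriv_char0 (p : {poly F}) n : size p = n.+2 -> size p^`() = n.+1.
Proof.
move=> sp; apply/eqP; rewrite eqn_leq; apply/andP; split.
  by rewrite -ltnS -sp lt_size_deriv // -size_poly_eq0 sp.
rewrite ltnNge; apply/negP => /leq_sizeP/(_ n (leqnn n)); rewrite coef_deriv.
move/eqP; rewrite mulrn_eq0 /= => /eqP pn.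
by have := lead_coef_eq0 p; rewrite lead_coefE sp /= pn eqxx -size_poly_eq0 sp.
Qed.

(** Applying E_01 repeatedly to a nonzero element of a submodule yields a nonzero
    constant, and applying E_10 to it yields multiples m (m - 1) ... (m - k + 1)
    of every monomial X^k, nonzero for k <= m. *)
Lemma forms_irreducible : gl2_irreducible form_act.
Proof.
have valZ a (p : forms) : val (a *: p) = a *: val p by [].
split.
  exists (monom 0); apply/eqP => /(congr1 val); rewrite val_monom // => /eqP.
  by rewrite expr0 oner_eq0.
move=> P [P0 Plin Pact].
have PZ a v : P v -> P (a *: v) by move=> Pv; rewrite -[_ *: _]addr0; apply: Plin.
have [Pz|Pnz] := pselect (forall v, P v -> v = 0); [by left | right].
have [v [Pv v0]] : exists v, P v /\ v <> 0.
  apply: contrapT => noP; apply: Pnz => v Pv; apply: contrapT => v0.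
  by apply: noP; exists v.
have P1 : P (monom 0).
  have [n] : exists n, size (val v) = n.+1.
    exists (size (val v)).-1; rewrite prednK // size_poly_gt0.
    by apply/eqP => v_eq0; apply/v0/val_inj.
  elim: n v Pv {v0} => [|n IHn] v Pv sv; last first.
    apply: (IHn (form_act (delta_mx 0 1) v)); first exact: Pact.
    by rewrite form_actE form_op_raise; apply: size_deriv_char0.
  have vC := size1_polyC (eq_leq sv).
  have c0 : (val v)`_0 != 0.
    by rewrite -polyC_eq0 -vC -size_poly_eq0 sv.
  suff -> : monom 0 = ((val v)`_0)^-1 *: v by apply: PZ.
  apply: val_inj; rewrite val_monom // valZ {2}vC -mul_polyC -polyCM mulVf //.
have Pk k : (k <= m)%N -> P (monom k).
  elim: k => // k IHk km.
  suff -> : monom k.+1 = (m%:R - k%:R)^-1 *: form_act (delta_mx 1 0) (monom k).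
    by apply/PZ/Pact/IHk/ltnW.
  apply: val_inj; rewrite valZ form_actE !val_monom ?(ltnW km) //.
  rewrite form_op_monom gl2_mxtrace !mxE /= !mulr0 !addr0 subr0 !mulr0 mul0r scale0r !add0r addr0.
  rewrite scale0r add0r mul1r scalerA mulVf ?scale1r //.
  by rewrite subr_eq0 eqr_nat gtn_eqF.
move=> u; rewrite (forms_sum u).
elim/big_ind: _ => [//|x y Px Py|k _]; last by apply/PZ/Pk; rewrite -ltnS.
by rewrite -[x]scale1r; apply: Plin.
Qed.

(** The highest weight vector is 1, which stands for x^m; the identity acts on
    forms of degree m by m, and the twist adds s times the trace 2. *)
Lemma forms_gl2_L : gl2_L m (m%:R + 2 * s) form_act.
Proof.
have valZ a (p : forms) : val (a *: p) = a *: val p by [].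
split; [exact: form_act_module | exact: forms_irreducible | exists (monom 0) |].
  split.
  - apply/eqP => /(congr1 val); rewrite val_monom // => /eqP.
    by rewrite expr0 oner_eq0.
  - apply: val_inj; rewrite form_actE val_monom // form_op_monom gl2_mxtrace !mxE /=.
    by rewrite !(mulr0, mul0r, subr0, addr0, scale0r).
  - apply: val_inj; rewrite form_actE valZ val_monom // form_op_monom gl2_mxtrace !mxE /=.
    by rewrite !(mulr0, mul0r, subr0, addr0, scale0r, sub0r, mulr1, subrr).
move=> v; apply: val_inj; rewrite form_actE valZ /form_op gl2_mxtrace !mxE /=.
rewrite -mul_polyC !(rmorphD, rmorphB, rmorphM) /=; ring.
Qed.
End BinaryForms.

(** * Derivations acting on the cohomology *)

Section Action.
Variable F : numFieldType.
Local Notation ev := (@ev F 3).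

(** The derivation of n that is A on the span of e_0, e_1 and tr A on e_2. *)
Definition derivation (A : 'M[F]_2) : cochain F 3 :=
  \sum_i \sum_j A i j *: ev (matrix_unit i j).

Lemma derivation_is_linear : linear derivation.
Proof.
move=> a A B; rewrite /derivation scaler_sumr -big_split; apply: eq_bigr => i _.
rewrite /= scaler_sumr -big_split; apply: eq_bigr => j _ /=.
by rewrite !mxE scalerDl scalerA.
Qed.
HB.instance Definition _ :=
  GRing.isLinear.Build F 'M[F]_2 (cochain F 3) *:%R derivation derivation_is_linear.

Lemma derivation_delta i j : derivation (delta_mx i j) = ev (matrix_unit i j).
Proof.
rewrite /derivation (bigD1 i) //= (bigD1 j) //= mxE !eqxx scale1r.
rewrite !big1 ?addr0 // => k /negPf ki; rewrite ?big1 // => *;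
  by rewrite mxE ki ?andbF scale0r.
Qed.

Lemma derivation_comb A :
  derivation A = comb matrix_units (nth 0 [:: A 0 0; A 0 1; A 1 0; A 1 1]).
Proof.
rewrite /derivation !big_I2 /comb !big_ord_recl big_ord0 addr0 addrA.
by rewrite !addrA.
Qed.

Lemma all_I2 (P : pred 'I_2) : all P [:: 0; 1] -> forall i, P i.
Proof.
case/and3P => P0 P1 _ [[|[|//]] ilt]; first by congr P: P0; apply: val_inj.
by congr P: P1; apply: val_inj.
Qed.

Lemma bracket_derivation A B :
  bracket (derivation A) (derivation B) = derivation (lie A B).
Proof.
move: A; apply: eq_on_delta => [a A A'|a A A'|i j].
- by rewrite linearP bracket_linearl.
- rewrite -linearP; congr derivation.
  by rewrite /lie mulmxDl mulmxDr -scalemxAl -scalemxAr scalerBr opprD addrACA.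
move: B; apply: eq_on_delta => [a B B'|a B B'|k l].
- by rewrite linearP bracket_linearr.
- rewrite -linearP; congr derivation.
  by rewrite /lie mulmxDl mulmxDr -scalemxAl -scalemxAr scalerBr opprD addrACA.
rewrite !derivation_delta bracket_ev /lie !mul_delta_mx_cond.
rewrite linearB /= !raddfMn /= !derivation_delta.
have /all_I2/(_ i)/all_I2/(_ j)/all_I2/(_ k)/all_I2/(_ l) := matrix_units_check.
move=> /(@vanishes_sub F) ->; rewrite ev_sub !ev_scale.
by rewrite -!pmulrn !scaler_nat ?mulNrn.
Qed.

Section Forms.
Variables (m : nat) (s : int) (r : seq (formal_sum 3)).
Hypothesis r_forms : acts_as_forms m s r.

Definition expand (p : {poly F}) : cochain F 3 := comb r (fun i => p`_i).

Lemma expand_is_linear : linear expand.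
Proof.
move=> a p q; rewrite /expand /comb scaler_sumr -big_split; apply: eq_bigr => i _.
by rewrite /= coefD coefZ scalerDl scalerA.
Qed.
HB.instance Definition _ :=
  GRing.isLinear.Build F {poly F} (cochain F 3) *:%R expand expand_is_linear.

Lemma expandXn k : expand 'X^k = ev (nth [::] r k).
Proof.
rewrite /expand /comb; have [kr|rk] := ltnP k (size r); last first.
  rewrite nth_default // [RHS]big_nil big1 // => i _.
  by rewrite coefXn ltn_eqF ?scale0r // (leq_trans _ rk).
rewrite (bigD1 (Ordinal kr)) //= coefXn eqxx scale1r big1 ?addr0 // => i.
by rewrite -val_eqE coefXn /= => /negPf ->; rewrite scale0r.
Qed.

(** Equality holds for cochains and not only for their classes, because of the
    choice of r. *)
Lemma bracket_expand A (p : {poly_m.+1 F}) :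
  bracket (derivation A) (expand (val p)) = expand (form_op m s%:~R A (val p)).
Proof.
have -> : val p = \sum_(k < m.+1) (val p)`_k *: 'X^k.
  by rewrite -poly_def; apply/polyP=> i; rewrite coef_poly; case: ltnP => // /(big_coef_npoly p).
move: A; apply: eq_on_delta => [a A B|a A B|i j].
- by rewrite linearP bracket_linearl.
- by rewrite form_op_linearl linearP.
pose f q := bracket (derivation (delta_mx i j)) (expand q).
pose g q := expand (form_op m s%:~R (delta_mx i j) q).
have fP : linear f by move=> a q q'; rewrite /f linearP bracket_linearr.
have gP : linear g by move=> a q q'; rewrite /g form_op_linear linearP.
have fg k : (k <= m)%N -> f 'X^k = g 'X^k.
  move=> km; rewrite /f /g derivation_delta expandXn bracket_ev form_op_monom.
  rewrite !linearD !linearZ /= !expandXn gl2_mxtrace !mxE.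
  have /allP/(_ k) := r_forms; rewrite mem_iota => /(_ km)/and4P[].
  move=> /(@vanishes_sub F) + /(@vanishes_sub F) + /(@vanishes_sub F) + /(@vanishes_sub F).
  rewrite !ev_scale => e00 e11 e01 e10.
  case: (I2P i) => ->; case: (I2P j) => -> /=;
    [rewrite e00 | rewrite e01 | rewrite e10 | rewrite e11];
    rewrite !(mulr0, mulr1, mul0r, mul1r, scale0r, addr0, add0r, subr0, sub0r, oppr0);
    by congr (_ *: _); rewrite ?intrD ?rmorphN -?pmulrn //; ring.
rewrite -/(f _) -/(g _) !linear_comb //.
by apply: eq_bigr => k _; rewrite fg // -ltnS.
Qed.
End Forms.
End Action.

(** * Root vectors *)

Section RootVectors.
Variables (F : numFieldType) (N : nat) (x : 'I_N -> 'I_N -> 'M[F]_N).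
Hypothesis x_chev : chevalley x.

(** A matrix entry (k, l) other than (i, j) vanishes because some diagonal
    matrix h has h_k - h_l different from h_i - h_j: one diagonal matrix unit
    is enough in each case. *)
Lemma root_vectorE i j : i != j -> x i j = x i j i j *: delta_mx i j.
Proof.
move=> ij; have [weight _ _] := x_chev.
have ent k l (h : 'rV[F]_N) : (h 0 k - h 0 l - (h 0 i - h 0 j)) * x i j k l = 0.
  have /matrixP/(_ k l) := weight i j ij h.
  rewrite /lie mul_diag_mx mul_mx_diag !mxE => w.
  by rewrite mulrBl -w; ring.
pose dl (n : 'I_N) : 'rV[F]_N := \row_k' (k' == n)%:R.
have zero k l (h : 'rV[F]_N) : h 0 k - h 0 l != h 0 i - h 0 j -> x i j k l = 0.
  by rewrite -subr_eq0 => /negPf h0; have /eqP := ent k l h; rewrite mulf_eq0 h0 => /eqP.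
apply/matrixP => k l; rewrite !mxE.
have [ki|ki] := eqVneq k i; last first.
  rewrite /= mulr0; have [kl|kl] := eqVneq k l.
    by apply: (zero _ _ (dl i)); rewrite !mxE kl subrr eqxx [j == i]eq_sym
      (negPf ij) subr0 eq_sym oner_eq0.
  apply: (zero _ _ (dl k)); rewrite !mxE eqxx [l == k]eq_sym (negPf kl)
    [i == k]eq_sym (negPf ki) subr0 sub0r.
  case: (j == k); first by rewrite -addr_eq0 -(natrD _ 1 1) pnatr_eq0.
  by rewrite oppr0 oner_eq0.
rewrite ki; have [lj|lj] := eqVneq l j; first by rewrite lj mulr1.
rewrite mulr0; apply: (zero _ _ (dl j)).
by rewrite !mxE eqxx (negPf ij) (negPf lj) subrr sub0r eq_sym oppr_eq0 oner_eq0.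
Qed.

(** Otherwise the coroot would vanish. *)
Lemma root_vector_neq0 i j : i != j -> x i j i j != 0.
Proof.
move=> ij; have [_ coroot _] := x_chev.
have ji : j != i by rewrite eq_sym.
have /matrixP/(_ i i) := coroot i j ij.
rewrite (root_vectorE ij) (root_vectorE ji) /lie.
rewrite -!scalemxAl -!scalemxAr !mul_delta_mx !mxE !eqxx (negPf ij) /=.
rewrite !mulr0 !mulr1 !subr0; apply: contra_eqN => /eqP ->.
by rewrite mul0r eq_sym oner_eq0.
Qed.
End RootVectors.

Section SL3.
Variables (F : numFieldType) (x : 'I_3 -> 'I_3 -> 'M[F]_3).
Hypothesis x_chev : chevalley x.
Local Notation e := (nil_sl3 x).

Lemma nil_sl3_free : free e.
Proof.
have nz := root_vector_neq0 x_chev; have xE := root_vectorE x_chev.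
apply/freeP => k; rewrite !big_ord_recl big_ord0 /= => /matrixP k0.
have k_0 := k0 0 1; have k_1 := k0 1 2; have k_2 := k0 0 2.
move: k_0 k_1 k_2; rewrite (xE 0 1) // (xE 1 2) // (xE 0 2) // !mxE /=.
rewrite !(mulr0, mulr1, addr0, add0r).
move=> /eqP + /eqP + /eqP; rewrite !mulf_eq0 !(negPf (nz _ _ _)) ?orbF //.
move=> /eqP k_0 /eqP k_1 /eqP k_2.
by case=> [[|[|[|//]]] ?]; [rewrite -k_0 | rewrite -k_1 | rewrite -k_2]; congr k; apply: val_inj.
Qed.

(** The ratio t is the structure constant of the Chevalley basis for the two
    simple roots. *)
Lemma nil_sl3_heisenberg : exists2 t : F, t != 0 &
  forall i j b, coord e b (lie (tnth e i) (tnth e j)) = t * (heis_const i j b)%:~R.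
Proof.
have nz := root_vector_neq0 x_chev; have xE := root_vectorE x_chev.
pose t := x 0 1 0 1 * x 1 2 1 2 / x 0 2 0 2.
exists t; first by rewrite !mulf_neq0 ?invr_neq0 ?nz.
have xx i j k l : i != j -> k != l -> x i j *m x k l =
    (j == k)%:R *: ((x i j i j * x k l k l) *: delta_mx i l).
  move=> ij kl; rewrite (xE i j ij) (xE k l kl) !mxE !eqxx !mulr1.
  rewrite -scalemxAl -scalemxAr scalerA mul_delta_mx_cond.
  by rewrite -[in RHS]scalerA [RHS]scaler_nat scalerMnr -scalerA.
have lieE i j : lie (tnth e i) (tnth e j) = (t * (heis_const i j 2)%:~R) *: x 0 2.
  have x02 : t *: x 0 2 = (x 0 1 0 1 * x 1 2 1 2) *: delta_mx 0 2.
    by rewrite (xE 0 2) // scalerA mulfVK ?nz.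
  rewrite [t * _]mulrC -scalerA x02 /lie; move: ( _ *: delta_mx 0 2) (xx 0 1 1 2 isT isT).
  move=> E xyE.
  have [xyE' yxE] := (xyE, xx 1 2 0 1 isT isT).
  have [xzE zxE] := (xx 0 1 0 2 isT isT, xx 0 2 0 1 isT isT).
  have [yzE zyE] := (xx 1 2 0 2 isT isT, xx 0 2 1 2 isT isT).
  move: xyE yxE xzE zxE yzE zyE; rewrite /= !scale0r.
  case: i => [[|[|[|//]]] ?]; case: j => [[|[|[|//]]] ?]; rewrite /heis_const !(tnth_nth 0) /=;
    move: (x 0 1) (x 1 2) (x 0 2) => X Y Z xy yx xz zx yz zy;
    rewrite ?subrr ?scale0r ?xy ?yx ?xz ?zx ?yz ?zy ?subr0 ?sub0r ?subrr //.
  by rewrite rmorphN1 scaleN1r scale1r.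
move=> i j b; rewrite lieE linearZ /=.
have -> : x 0 2 = e`_(nat_of_ord (2%R : 'I_3)) by [].
rewrite (coord_free _ _ nil_sl3_free).
have -> : heis_const i j b = heis_const i j 2 * (2 == b)%:Z.
  by rewrite /heis_const [b == 2]eq_sym; case: (2 == b); rewrite ?andbT ?andbF ?mulr1 ?mulr0.
by rewrite rmorphM mulrA; case: (2 == b).
Qed.
End SL3.

(** * The two Lie superalgebras *)

Section SL2.
Variables (F : numFieldType) (e : 1.-tuple 'M[F]_2).

Lemma diff_line u : diff e u = 0.
Proof.
rewrite /diff big1 // => p _; rewrite /diff_mono big1 => [|i _]; last first.
  rewrite big1 // => b _; rewrite (ord1 i) (ord1 p.1) /lie subrr linear0.
  by rewrite scale0r.
rewrite big1 ?subr0 ?scaler0 // => k _; rewrite big1 // => i _.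
by rewrite big1 // => j; rewrite (ord1 i) (ord1 j).
Qed.

Lemma cocycles_line u : u \in cocycles e.
Proof. by rewrite mem_cocycles diff_line. Qed.

Lemma repr_class_line u : vsval (repr (class e u)) = u.
Proof.
have /mem_coboundaries[v /eqP] := repr_class (cocycles_line u).
by rewrite diff_line subr_eq0 => /eqP.
Qed.

Lemma card1_line (S : {set 'I_1}) : #|S| == 1%N -> enum S = [:: 0].
Proof. by rewrite cardE; case: (enum S) => [|i []] // _; rewrite (ord1 i). Qed.

Lemma bracket_line u v : u \in cochains F 1 1 -> v \in cochains F 1 1 ->
  bracket u v = 0.
Proof.
move=> /mem_cochains u1 /mem_cochains v1.
rewrite /bracket big1 // => p _; rewrite big1 // => q _.
have [p1|/u1 ->] := boolP (#|p.2|%:Z == 1); last by rewrite mul0r scale0r.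
have [q1|/v1 ->] := boolP (#|q.2|%:Z == 1); last by rewrite mulr0 scale0r.
rewrite (ord1 p.1) (ord1 q.1) !card1_line // /bracket_mono /= mul0r expr0z scale1r.
by rewrite subrr scaler0.
Qed.

Lemma cochains_line u : u \in cochains F 1 1 <-> exists a, u = a *: mono F (0 : 'I_1) [:: 0].
Proof.
have monoE : mono F (0 : 'I_1) [:: 0] = basis_elt F (0 : 'I_1, [set 0]).
  by rewrite /basis_elt enum_set1.
rewrite monoE; split=> [/mem_cochains u1 | [a ->]].
  exists (u (0, [set 0])); apply/ffunP => p; rewrite ffunE basis_eltE.
  case: eqP => [->|p0]; first by rewrite [_ *: _]mulr1.
  rewrite [_ *: _]mulr0 u1 //; apply/negP => /card1_line p1; apply: p0.
  case: p p1 => a S /= S1; rewrite (ord1 a); congr pair; apply/setP => i.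
  by rewrite -mem_enum S1 !inE.
apply/mem_cochains => p p1; rewrite ffunE basis_eltE.
case: eqP => [pE|_]; last by rewrite [_ *: _]mulr0.
by rewrite pE cards1 eqxx in p1.
Qed.

(** The differential being 0, cohomology classes are cochains; and the bracket
    of e_0 f^0 with itself is a difference of equal terms. *)
Theorem cohomology_line :
     let c1 := mono F (0 : 'I_1) [:: 0] in
     [/\ c1 \in cocycles e,
         forall k : int, 0 < k -> forall y : lsuper e, lpart k y -> y = 0,
         forall y : lsuper e, lpart 0 y <-> exists a : F, y = a *: class e c1
       & forall y z : lsuper e, lpart 0 y -> lpart 0 z -> lbracket y z = 0].
Proof.
split=> [|k k_gt0 y [c]|y|y z [c + ->] [c' + ->]].
- exact: cocycles_line.
- rewrite memv_cap => /andP[_ /mem_cochains ck] ->.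
  suff -> : c = 0 by rewrite linear0.
  apply/ffunP => p; rewrite ffunE ck //; apply/eqP => pk.
  have : #|p.2|%:Z <= 1 by rewrite lez_nat -[X in (_ <= X)%N](card_ord 1) max_card.
  by rewrite pk leNgt ltrDr k_gt0.
- split=> [[c + ->] | [a ->]].
    by rewrite memv_cap => /andP[_ /cochains_line[a ->]]; exists a; rewrite linearZ.
  exists (a *: mono F (0 : 'I_1) [:: 0]); last by rewrite linearZ.
  rewrite memv_cap cocycles_line; apply/cochains_line; by exists a.
rewrite !memv_cap => /andP[_ c1] /andP[_ c1'].
by rewrite /lbracket !repr_class_line bracket_line // linear0.
Qed.
End SL2.

Section SL3.
Variables (F : numFieldType) (e : 3.-tuple 'M[F]_3) (t : F).
Hypothesis t_neq0 : t != 0.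
Hypothesis coord_lie : forall i j b,
  coord e b (lie (tnth e i) (tnth e j)) = t * (heis_const i j b)%:~R.

Lemma derivation_cocycle A : derivation A \in cocycles e.
Proof. by rewrite derivation_comb (comb_cocycle t_neq0 coord_lie bases1). Qed.

Lemma l0_iso : exists2 phi : {linear 'M[F]_2 -> lsuper e},
  forall A, phi A = class e (derivation A) & gl2_iso_l0 phi.
Proof.
pose x (A : 'M[F]_2) := nth 0 [:: A 0 0; A 0 1; A 1 0; A 1 1].
have [] := dual_bases_iso t_neq0 coord_lie bases1 (x := x).
- move=> i a A B; rewrite /x !mxE.
  by case: i => [|[|[|[|i]]]] //=; rewrite !nth_nil addr0 scaler0.
- move=> A A0; apply/matrixP => i j; rewrite mxE.
  have := (A0 0%N isT, A0 1%N isT, A0 2%N isT, A0 3%N isT).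
  rewrite /x /= => -[[[A00 A01] A10] A11].
  by case: (I2P i) => ->; case: (I2P j) => ->.
- move=> y; exists (\matrix_(i, j) y (i.*2 + j)%N) => i.
  by case: i => [|[|[|[|i]]]] // _; rewrite /x /= mxE.
move=> phi [phi_inj phi_im phi_comb].
have phiE A : phi A = class e (derivation A) by rewrite derivation_comb.
exists phi => //; split=> // A B.
by rewrite !phiE (lbracket_class t_neq0 coord_lie) ?derivation_cocycle // bracket_derivation.
Qed.

Section Parts.
Variable phi : {linear 'M[F]_2 -> lsuper e}.
Hypothesis phiE : forall A, phi A = class e (derivation A).

Lemma lbracket_phi A u : u \in cocycles e ->
  lbracket (phi A) (class e u) = class e (bracket (derivation A) u).
Proof.
by move=> Zu; rewrite phiE (lbracket_class t_neq0 coord_lie) ?derivation_cocycle.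
Qed.

(** On these representatives the isomorphism intertwines the actions already at
    the level of cochains. *)
Lemma lpart_forms k r l m s : dual_bases k r l -> size r = m.+1 ->
  acts_as_forms m s r -> lpart_iso phi (k%:Z - 1) (form_act (m := m) s%:~R).
Proof.
move=> rl size_r r_forms.
have [] := dual_bases_iso t_neq0 coord_lie rl
  (x := fun (p : {poly_m.+1 F}) i => (val p)`_i).
- by move=> i a p q; rewrite coefD coefZ.
- move=> p p0; apply/val_inj/polyP => i; rewrite coef0.
  have [im|/big_coef_npoly -> //] := ltnP i m.+1.
  by rewrite p0 ?size_r.
- move=> y; exists (mk_npoly m.+1 y) => i ir.
  by rewrite /= coef_poly -size_r ir.
move=> psi [psi_inj psi_im psiE]; exists psi; split=> // A p.
rewrite !psiE lbracket_phi ?(comb_cocycle t_neq0 coord_lie rl) //.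
by rewrite (bracket_expand r_forms) // form_actE.
Qed.

Lemma lpart_forms2 k r r' l m s m' s' : dual_bases k (r ++ r') l ->
  size r = m.+1 -> size r' = m'.+1 ->
  acts_as_forms m s r -> acts_as_forms m' s' r' ->
  lpart_iso phi (k%:Z - 1)
    (gl2_sum (form_act (m := m) s%:~R) (form_act (m := m') s'%:~R)).
Proof.
move=> rl size_r size_r' r_forms r_forms'.
pose x (p : {poly_m.+1 F} * {poly_m'.+1 F}) i :=
  if (i < size r)%N then (val p.1)`_i else (val p.2)`_(i - size r).
have comb_x p : comb (r ++ r') (x p) = expand r (val p.1) + expand r' (val p.2).
  rewrite comb_cat; congr (_ + _); apply: eq_comb => i ir; rewrite /x ?ir //.
  by rewrite ltnNge leq_addr addKn.
have [] := dual_bases_iso t_neq0 coord_lie rl (x := x).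
- by move=> i a p q; rewrite /x; case: ifP => _; rewrite coefD coefZ.
- move=> p p0; rewrite [p]surjective_pairing; congr pair; apply/val_inj/polyP => i; rewrite coef0.
    have [im|/big_coef_npoly -> //] := ltnP i m.+1.
    have := p0 i; rewrite /x size_cat size_r im ltn_addr //; exact.
  have [im|/big_coef_npoly -> //] := ltnP i m'.+1.
  have := p0 (size r + i)%N; rewrite /x size_cat ltn_add2l size_r' im.
  by rewrite ltnNge leq_addr addKn; apply.
- move=> y; exists (mk_npoly m.+1 y, mk_npoly m'.+1 (fun i => y (size r + i)%N)) => i.
  rewrite size_cat /x /= !coef_poly => ir.
  case: ltnP => [im|mi]; first by rewrite -size_r im.
  by rewrite -size_r' ltn_subLR // ir subnKC.
move=> psi [psi_inj psi_im psiE]; exists psi; split=> // A p.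
rewrite !psiE lbracket_phi ?(comb_cocycle t_neq0 coord_lie rl) // !comb_x.
have -> u v w : bracket u (v + w) = bracket u v + bracket u w :> cochain F 3.
  by rewrite -[v]scale1r bracket_linearr !scale1r.
by rewrite (bracket_expand r_forms) // (bracket_expand r_forms') // !form_actE.
Qed.
End Parts.
End SL3.

Theorem cohomology_sl3 (F : numFieldType) (x : 'I_3 -> 'I_3 -> 'M[F]_3) :
  chevalley x -> let e := nil_sl3 x in
     let c1 := mono F (0 : 'I_3) [:: 0] + mono F (2 : 'I_3) [:: 2] in
     let c2 := mono F (1 : 'I_3) [:: 1] + mono F (2 : 'I_3) [:: 2] in
     let b1 := mono F (1 : 'I_3) [:: 0] in
     let b2 := mono F (0 : 'I_3) [:: 1] in
     [/\ {subset [:: c1; c2; b1; b2] <= cocycles e},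
         lbracket (class e b1) (class e b2) = class e c2 - class e c1
       & exists phi : {linear 'M[F]_2 -> lsuper e},
         [/\ gl2_iso_l0 phi,
             phi (delta_mx 0 0) = class e c1 /\ phi (delta_mx 1 1) = class e c2,
             exists (V : lmodType F) (rho : 'M[F]_2 -> V -> V),
               gl2_L 0%N 2 rho /\ lpart_iso phi (-1) rho,
             exists (V1 V2 : lmodType F) (rho1 : 'M[F]_2 -> V1 -> V1)
                 (rho2 : 'M[F]_2 -> V2 -> V2),
               [/\ gl2_L 2%N (-2) rho1, gl2_L 1%N (-1) rho2
                 & lpart_iso phi 1 (gl2_sum rho1 rho2)]
           & exists (V : lmodType F) (rho : 'M[F]_2 -> V -> V),
               gl2_L 1%N (-3) rho /\ lpart_iso phi 2 rho]].
Proof.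
move=> x_chev e c1 c2 b1 b2.
have [t t_neq0 coord_lie] := nil_sl3_heisenberg x_chev.
have w0 : widen_ord (leqnSn 2) 0 = 0 by apply: val_inj.
have w1 : widen_ord (leqnSn 2) 1 = 1 by apply: val_inj.
have c1E : c1 = derivation (delta_mx 0 0).
  by rewrite derivation_delta /ev /matrix_unit /= big_cons big_seq1 /= !scale1r w0.
have c2E : c2 = derivation (delta_mx 1 1).
  by rewrite derivation_delta /ev /matrix_unit /= big_cons big_seq1 /= !scale1r w1.
have b1E : b1 = derivation (delta_mx 1 0).
  by rewrite derivation_delta /ev /matrix_unit /= big_seq1 /= !scale1r w1 w0.
have b2E : b2 = derivation (delta_mx 0 1).
  by rewrite derivation_delta /ev /matrix_unit /= big_seq1 /= !scale1r w1 w0.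
have Zder A := derivation_cocycle t_neq0 coord_lie A.
have [phi phiE phi_iso] := l0_iso t_neq0 coord_lie.
rewrite c1E c2E b1E b2E; split.
- by move=> u; rewrite !inE => /or4P[] /eqP ->; apply: Zder.
- rewrite (lbracket_class t_neq0 coord_lie) ?Zder // bracket_derivation -!linearB /=.
  by congr (class e (derivation _)); rewrite /lie !mul_delta_mx.
(* The identity acts by m + 2 s, which determines the twist s in each degree. *)
have part := lpart_forms t_neq0 coord_lie phiE.
exists phi; split=> //.
- exists {poly_1 F}, (form_act (m := 0) 1%:~R); split; last exact: part bases0 _ forms0.
  by have := forms_gl2_L 0 (1%:~R : F); rewrite add0r mulr1.
- exists {poly_3 F}, {poly_2 F}, (form_act (m := 2) (-2)%:~R), (form_act (m := 1) (-1)%:~R).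
  split; last exact: (lpart_forms2 t_neq0 coord_lie phiE bases2 _ _ forms2 forms1).
    by have := forms_gl2_L 2 ((-2)%:~R : F); rewrite (_ : _ + _ = -2) //; ring.
  by have := forms_gl2_L 1 ((-1)%:~R : F); rewrite (_ : _ + _ = -1) //; ring.
exists {poly_2 F}, (form_act (m := 1) (-2)%:~R); split; last exact: part bases3 _ forms3.
by have := forms_gl2_L 1 ((-2)%:~R : F); rewrite (_ : _ + _ = -3) //; ring.
Qed.

Theorem mainTheorem5 (R : realType) :
  (forall x : 'I_2 -> 'I_2 -> 'M[R[i]]_2, chevalley x ->
     let e := nil_sl2 x in
     let c1 := mono R[i] (0 : 'I_1) [:: 0] in
     [/\ c1 \in cocycles e,
         forall k : int, 0 < k -> forall y : lsuper e, lpart k y -> y = 0,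
         forall y : lsuper e, lpart 0 y <-> exists a : R[i], y = a *: class e c1
       & forall y z : lsuper e, lpart 0 y -> lpart 0 z -> lbracket y z = 0])
  /\
  (forall x : 'I_3 -> 'I_3 -> 'M[R[i]]_3, chevalley x ->
     let e := nil_sl3 x in
     let c1 := mono R[i] (0 : 'I_3) [:: 0] + mono R[i] (2 : 'I_3) [:: 2] in
     let c2 := mono R[i] (1 : 'I_3) [:: 1] + mono R[i] (2 : 'I_3) [:: 2] in
     let b1 := mono R[i] (1 : 'I_3) [:: 0] in
     let b2 := mono R[i] (0 : 'I_3) [:: 1] in
     [/\ {subset [:: c1; c2; b1; b2] <= cocycles e},
         lbracket (class e b1) (class e b2) = class e c2 - class e c1
       & exists phi : {linear 'M[R[i]]_2 -> lsuper e},
         [/\ gl2_iso_l0 phi,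
             phi (delta_mx 0 0) = class e c1 /\ phi (delta_mx 1 1) = class e c2,
             exists (V : lmodType R[i]) (rho : 'M[R[i]]_2 -> V -> V),
               gl2_L 0%N 2 rho /\ lpart_iso phi (-1) rho,
             exists (V1 V2 : lmodType R[i]) (rho1 : 'M[R[i]]_2 -> V1 -> V1)
                 (rho2 : 'M[R[i]]_2 -> V2 -> V2),
               [/\ gl2_L 2%N (-2) rho1, gl2_L 1%N (-1) rho2
                 & lpart_iso phi 1 (gl2_sum rho1 rho2)]
           & exists (V : lmodType R[i]) (rho : 'M[R[i]]_2 -> V -> V),
               gl2_L 1%N (-3) rho /\ lpart_iso phi 2 rho]]).
Proof.
by split=> x x_chev; [apply: cohomology_line | apply: cohomology_sl3].
Qed.
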